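(* Let $f(z)$ be a complex polynomial of degree larger than $1$ such that $|f'|>1$ on the Julia set $J(f)$. Let $(g_k)_{k=1}^\infty$ be a sequence of Hölder continuous functions $g_k:J(f)\to\mathbb C$ such that no $g_k$ is cohomologous to a constant with respect to $(f,J(f))$. Then the set of points $z\in J(f)$ such that the ergodic averages of $g_k$ do not converge for any $g_k$, i.e. such that for every $k$ the sequence $\frac1N\sum_{l=0}^{N-1}g_k(f^l(z))$ does not converge as $N\to\infty$, has the same Hausdorff dimension as $J(f)$.
   Context: A function $g:J(f)\to\mathbb C$ is cohomologous to a constant with respect to $(f,J(f))$ if $g=c+u-u\circ f$ on $J(f)$ for some constant $c\in\mathbb C$ and some continuous $u:J(f)\to\mathbb C$. *)

(* Defs.v *)
From HB Require Import structures.
From mathcomp Require Import all_boot all_order all_algebra.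
From mathcomp Require Import complex.
From mathcomp Require Import all_classical all_reals all_analysis.

Set Implicit Arguments.
Unset Strict Implicit.
Unset Printing Implicit Defensive.

Import Order.TTheory GRing.Theory Num.Theory.
Import numFieldNormedType.Exports.

Local Open Scope classical_set_scope.
Local Open Scope ring_scope.
Local Open Scope complex_scope.

(* The complex plane is R[i] for R : realType.  [R[i]^o] is R[i] seen as a normed
   space over itself; the library attaches the topology to this alias.  The norm
   of that space is R[i]-valued; [cabs] is the same modulus with values in R. *)
Definition cabs (R : realType) (z : R[i]) : R := ComplexField.Normc.normc z.

(* Normality of a family of entire functions, in the sense of Montel: locally
   uniform convergence of a subsequence, to a finite function or to infinity. *)
Definition normal_family (R : realType) (F : set (R[i]^o -> R[i]^o))
    (U : set R[i]^o) : Prop :=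
  forall h : nat -> R[i]^o -> R[i]^o, (forall n, F (h n)) ->
  exists2 s : nat -> nat, {homo s : m n / (m < n)%N} &
    (exists phi : R[i]^o -> R[i]^o, forall K : set R[i]^o,
       compact K -> K `<=` U -> {uniform K, h (s n) @[n --> \oo] --> phi})
    \/
    (forall K : set R[i]^o, compact K -> K `<=` U ->
       forall M : R, \forall n \near \oo,
         forall z : R[i]^o, K z -> M < cabs (h (s n) z)).

Definition iterate (R : realType) (f : {poly R[i]}) (n : nat) :
    R[i]^o -> R[i]^o := iter n (horner f).

(* The point at infinity, a superattracting fixed point when deg f >= 2, always
   belongs to the Fatou set, so both sets are taken inside the plane.  Allowing
   only the two uniform alternatives of [normal_family] on U loses nothing,
   because U can be shrunk to a disc. *)
Definition fatou_set (R : realType) (f : {poly R[i]}) : set R[i]^o :=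
  [set z | exists2 U : set R[i]^o, open_nbhs z U &
             normal_family (range (iterate f)) U].

Definition julia_set (R : realType) (f : {poly R[i]}) : set R[i]^o :=
  ~` fatou_set f.

Definition diameter (R : realType) (A : set R[i]^o) : \bar R :=
  ereal_sup [set (cabs (x - y))%:E | x in A & y in A].

(* diam(A)^s, with 0^0 = 1 for nonempty A, and 0 for the empty set (whose
   [diameter] is -oo). *)
Definition diameter_pow (R : realType) (s : R) (A : set R[i]^o) : \bar R :=
  if A == set0 then 0%E else poweR (diameter A) s.

Definition hausdorff_premeasure (R : realType) (s delta : R)
    (A : set R[i]^o) : \bar R :=
  ereal_inf [set (\sum_(0 <= n <oo) diameter_pow s (U n))%E |
    U in [set U : nat -> set R[i]^o |
            A `<=` \bigcup_n U n /\
            forall n, (diameter (U n) <= delta%:E)%E]].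

Definition hausdorff_measure (R : realType) (s : R)
    (A : set R[i]^o) : \bar R :=
  ereal_sup [set hausdorff_premeasure s delta A | delta in [set d | 0 < d]].

Definition hausdorff_dim (R : realType) (A : set R[i]^o) : \bar R :=
  ereal_inf [set s%:E | s in [set s : R | 0 <= s /\
                                 hausdorff_measure s A = 0%E]].

Definition holder_on (R : realType) (A : set R[i]^o)
    (g : R[i]^o -> R[i]^o) : Prop :=
  exists alpha c : R, [/\ 0 < alpha, alpha <= 1 &
    forall x y : R[i]^o, A x -> A y ->
      cabs (g x - g y) <= c * (cabs (x - y)) `^ alpha].

(* Functions on J(f) are represented by total functions of which only the
   values on J(f) matter. *)
Definition cohomologous_to_constant (R : realType) (f : {poly R[i]})
    (g : R[i]^o -> R[i]^o) : Prop :=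
  exists (c : R[i]^o) (u : R[i]^o -> R[i]^o),
    {within julia_set f, continuous u} /\
    forall z : R[i]^o, julia_set f z -> g z = c + u z - u f.[z].

Definition ergodic_average (R : realType) (f : {poly R[i]})
    (g : R[i]^o -> R[i]^o) (z : R[i]^o) (N : nat) : R[i]^o :=
  N%:R^-1 * \sum_(l < N) g (iterate f l z).

(* Main.v *)
Require Import Defs.
From HB Require Import structures.
From mathcomp Require Import all_boot all_order all_algebra.
From mathcomp Require Import complex.
From mathcomp Require Import all_classical all_reals all_analysis.
From mathcomp Require Import ring lra zify.
Set Implicit Arguments.
Unset Strict Implicit.
Unset Printing Implicit Defensive.
Import Order.TTheory GRing.Theory Num.Theory.
Import numFieldNormedType.Exports.
Local Open Scope classical_set_scope.
Local Open Scope ring_scope.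
Local Open Scope complex_scope.

(** One inequality is monotonicity of the dimension. For the other one, let
    t < dim J(f) and let the sets U_j have a small total sum of diam(U_j)^t;
    it is enough to find a point of J(f) outside all U_j at which the
    averages of every g_k diverge.

    The map f expands distances near J(f). Its inverse branches along an
    orbit distort ratios of distances by a bounded factor, because f' is
    Lipschitz and distances along the pulled back orbit decay geometrically.
    Moreover the iterates of any disc centred on J(f) cover J(f) after a
    number of steps that depends on the radius only
    ([julia_expanding_system]). This is where Montel's theorem is normally
    used. Here, if f^n omits a point a of J(f) on a disc centred on J(f),
    then pulling back along inverse branches shows that f^n stays away from
    a on the disc of half the radius, for large n by a distance that does
    not depend on n; so Cauchy's estimate for 1 / (f^n - a)
    ([cauchy_inverse]) bounds the derivative of f^n at the centre, which
    grows exponentially. The rest of the argument takes place in a metric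
    space with an expanding exact map ([expanding_system]).

    If the Birkhoff sums of length n of a real Hölder function phi differ
    from one another by at most a constant independent of n, then phi is
    cohomologous to a constant ([bounded_oscillation_cohomologous]).
    Otherwise there are two loops of equal length at a base point a along
    which the sums of phi differ by much, and repeating them gives loops
    whose sums differ by an amount proportional to their length
    ([returning_loops]). This is applied to the real or to the imaginary
    part of each g_k.

    Take t < t' < dim J(f). Pulling back J(f) by n-step inverse branches
    gives covers, and as the t'-dimensional measure of J(f) is positive, the
    sum of |(f^N)'|^(-t') over the N-th preimages of a near a is bounded
    from below; hence the same sum with exponent t grows exponentially with
    N ([many_returns]).

    The point sought is the limit of a path in a tree of inverse branches. A
    node that stands for an orbit segment of length T carries a mass that is
    at most |(f^T)'|^(-t). At most nodes the tree branches over the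
    preimages of [many_returns], the mass is shared in proportion to
    |(f^N)'|^(-t), and the bound on the mass gains a fixed factor. Whenever
    enough has been gained, a single loop from [returning_loops] is
    inserted, of length proportional to T, for the function g_k whose turn
    it is; of two possible loops, one that moves the average by a definite
    amount. Every k has its turn infinitely often, so none of the averages
    converges along any path. Since sets of diameter r meet two children of
    a node only if the mass of the node is at most a constant times r^t,
    following children in which the U_j take up less than their share of
    mass leads to a path that avoids all U_j ([tree_escape]). *)

(** * Birkhoff sums, derivative cocycles and elementary estimates *)

Section Orbits.
Variables (R : realType) (X : Type) (f : X -> X).

Definition birkhoff (phi : X -> R) (n : nat) (x : X) : R :=
  \sum_(i < n) phi (iter i f x).

(** For w the modulus of the derivative, this is the modulus of the derivative
    of the n-th iterate. *)
Definition cocycle (w : X -> R) (n : nat) (x : X) : R :=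
  \prod_(i < n) w (iter i f x).

Lemma birkhoffD phi m n x :
  birkhoff phi (m + n) x = birkhoff phi m x + birkhoff phi n (iter m f x).
Proof.
rewrite /birkhoff big_split_ord /=; congr (_ + _).
by apply: eq_bigr => i _; rewrite addnC iterD.
Qed.

Lemma birkhoff0 phi x : birkhoff phi 0 x = 0.
Proof. by rewrite /birkhoff big_ord0. Qed.

Lemma birkhoff1 phi x : birkhoff phi 1 x = phi x.
Proof. by rewrite /birkhoff big_ord1. Qed.

Lemma cocycleD w m n x :
  cocycle w (m + n) x = cocycle w m x * cocycle w n (iter m f x).
Proof.
rewrite /cocycle big_split_ord /=; congr (_ * _).
by apply: eq_bigr => i _; rewrite addnC iterD.
Qed.

Lemma cocycle0 w x : cocycle w 0 x = 1.
Proof. by rewrite /cocycle big_ord0. Qed.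

Lemma birkhoffB_const phi (c : R) n x :
  birkhoff (fun y => phi y - c) n x = birkhoff phi n x - c *+ n.
Proof. by rewrite /birkhoff sumrB sumr_const card_ord. Qed.

End Orbits.

Lemma geometric_tail (R : realType) (q : R) n :
  1 < q -> \sum_(i < n) (q ^+ (n - i))^-1 <= (q - 1)^-1.
Proof.
move=> q1; have q0 : 0 < q by lra.
have q10 : 0 < q - 1 by lra.
suff -> : \sum_(i < n) (q ^+ (n - i))^-1 = (q - 1)^-1 * (1 - (q ^+ n)^-1).
  rewrite ler_piMr ?invr_ge0 ?ltW//.
  have : 0 < (q ^+ n)^-1 by rewrite invr_gt0 exprn_gt0.
  lra.
elim: n => [|n IH]; first by rewrite big_ord0 expr0 invr1 subrr mulr0.
rewrite big_ord_recl subn0.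
under eq_bigr do rewrite lift0 subSS.
rewrite IH exprS invfM.
have qn : q ^+ n != 0 by rewrite expf_neq0// gt_eqF.
by field; rewrite qn !gt_eqF.
Qed.

Lemma powR_gt1 (R : realType) (a al : R) : 1 < a -> 0 < al -> 1 < a `^ al.
Proof.
move=> a1 al0; have a0 : 0 < a by lra.
have := gt0_ltr_powR al0 (_ : 1 \in Num.nneg) (_ : a \in Num.nneg) a1.
by rewrite !nnegrE ltW// ltW// powR1; apply.
Qed.

Lemma expr_large (R : realType) (q A : R) : 1 < q ->
  exists n0, forall n, (n0 <= n)%N -> A <= q ^+ n.
Proof.
move=> q1; have bern n : 1 + n%:R * (q - 1) <= q ^+ n.
  elim: n => [|n IH]; first by rewrite mul0r addr0 expr0.
  rewrite exprS -natr1.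
  have n0 : 0 <= n%:R * (q - 1) ^+ 2 by rewrite mulr_ge0// sqr_ge0.
  have q0 : 0 <= q by lra.
  have := ler_wpM2l q0 IH; lra.
exists (Num.truncn (A / (q - 1))).+1 => n hn; apply: le_trans (bern n).
have q10 : 0 < q - 1 by lra.
rewrite -lerBlDl -ler_pdivrMr//.
apply: (@le_trans _ _ (A / (q - 1))); first by rewrite ler_pM2r ?invr_gt0//;
  lra.
apply/ltW/(lt_le_trans (truncnS_gt _)); by rewrite ler_nat.
Qed.

Lemma powR_expr (R : realType) (q t : R) n : 0 < q ->
  (q ^+ n) `^ t = (q `^ t) ^+ n.
Proof.
move=> q0; rewrite -powR_mulrn ?ltW// -powRrM mulrC powRrM powR_mulrn//.
exact: powR_ge0.
Qed.

(** * Expanding systems: shadowing and bounded distortion *)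

(** The properties of an expanding polynomial on its Julia set that the
    construction uses.  The function w stands for the modulus of the
    derivative; [es_upper], [es_lower] and [es_w_dist] say that f is conformal
    up to a relative error proportional to the distance.  In [es_lift], y has
    a preimage near every point whose image is near y: inverse branches exist
    on discs of radius del. *)
Record expanding_system (R : realType) (X : choiceType) (d : X -> X -> R)
    (f : X -> X) (w : X -> R) (lam L c del : R) : Prop := ExpandingSystem {
  es_dist_ge0 : forall x y, 0 <= d x y;
  es_dist_sym : forall x y, d x y = d y x;
  es_dist_triangle : forall y x z, d x z <= d x y + d y z;
  es_dist_eq0 : forall x y, d x y = 0 <-> x = y;
  es_bounded : exists M, forall x y, d x y <= M;
  es_complete : forall (u : nat -> X) (e : nat -> R),
    (forall r, 0 < r -> exists n, e n < r) ->
    (forall m n, (m <= n)%N -> d (u n) (u m) <= e m) ->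
    exists x, forall n, d x (u n) <= e n;
  es_lam : 1 < lam;
  es_del : 0 < del;
  es_c : 0 <= c;
  es_w_ge : forall x, lam <= w x;
  es_w_le : forall x, w x <= L;
  es_lipschitz : forall x y, d (f x) (f y) <= L * d x y;
  es_expand : forall x y, d x y <= del -> lam * d x y <= d (f x) (f y);
  es_upper : forall x y, d x y <= del ->
    d (f x) (f y) <= w x * d x y * (1 + c * d x y);
  es_lower : forall x y, d x y <= del ->
    w x * d x y <= d (f x) (f y) * (1 + c * d x y);
  es_w_dist : forall x y, d x y <= del -> w x <= w y * (1 + c * d x y);
  es_lift : forall x y, d (f x) y <= del ->
    exists2 x', f x' = y & lam * d x x' <= d (f x) y;
  es_exact : forall r, 0 < r ->
    exists2 n, (0 < n)%N &
      forall x a, exists2 y, d x y <= r & iter n f y = a;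
  es_finite : forall a, exists s : seq X, forall y, f y = a -> y \in s
}.

Section Expanding.
Variables (R : realType) (X : choiceType) (d : X -> X -> R) (f : X -> X).
Variables (w : X -> R) (lam L c del : R).
Hypothesis sys : expanding_system d f w lam L c del.

Local Notation D := (cocycle f w).
Local Notation S := (birkhoff f).

Let d_ge0 x y : 0 <= d x y := es_dist_ge0 sys x y.
Let d_sym x y : d x y = d y x := es_dist_sym sys x y.
Let d_tri y x z : d x z <= d x y + d y z := es_dist_triangle sys y x z.
Let lam1 : 1 < lam := es_lam sys.
Let del0 : 0 < del := es_del sys.
Let c0 : 0 <= c := es_c sys.

Let lam_gt0 : 0 < lam. Proof. by move: lam1; lra. Qed.

Let dxx x : d x x = 0. Proof. exact/(es_dist_eq0 sys). Qed.

Let w_gt0 x : 0 < w x. Proof. exact: lt_le_trans lam_gt0 (es_w_ge sys x). Qed.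

Lemma cocycle_gt0 n x : 0 < D n x.
Proof. by rewrite /cocycle prodr_gt0. Qed.

Lemma cocycle_ge n x : lam ^+ n <= D n x.
Proof.
rewrite /cocycle -[X in lam ^+ X]card_ord -prodr_const.
by apply: ler_prod => i _; rewrite ltW//= (es_w_ge sys).
Qed.

Lemma cocycle_le n x : D n x <= L ^+ n.
Proof.
rewrite /cocycle -[X in L ^+ X]card_ord -prodr_const.
by apply: ler_prod => i _; rewrite ltW//= (es_w_le sys).
Qed.

Lemma iter_lipschitz n x y : d (iter n f x) (iter n f y) <= L ^+ n * d x y.
Proof.
elim: n => [|n IH]; first by rewrite mul1r.
rewrite exprS -mulrA /=; apply: le_trans (es_lipschitz sys _ _) _.
by rewrite ler_pM2l// (lt_le_trans (w_gt0 x))// (es_w_le sys).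
Qed.

Definition tracks n x y :=
  forall i, (i <= n)%N -> d (iter i f x) (iter i f y) <= del.

Lemma tracks_sym n x y : tracks n x y -> tracks n y x.
Proof. by move=> h i /h; rewrite d_sym. Qed.

Lemma tracks_contract n x y i : tracks n x y -> (i <= n)%N ->
  lam ^+ (n - i) * d (iter i f x) (iter i f y) <= d (iter n f x) (iter n f y).
Proof.
move=> h /subnKC; move: (n - i)%N => k; elim: k i => [|k IH] i.
  by rewrite addn0 => ->; rewrite mul1r.
rewrite addnS -addSn => e; rewrite exprSr -mulrA.
apply: le_trans (IH _ e); rewrite ler_pM2l ?exprn_gt0//.
by apply: (es_expand sys); apply: h; rewrite -e; lia.
Qed.

Lemma tracks_contract_le n x y i r : tracks n x y -> (i <= n)%N ->
  d (iter n f x) (iter n f y) <= r -> d (iter i f x) (iter i f y) <= r.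
Proof.
move=> h i_n; apply: le_trans; apply: le_trans (tracks_contract h i_n).
by rewrite ler_peMl// exprn_ege1// ltW.
Qed.

(** Lifting y step by step along the orbit of x: each lift contracts the
    distance, so the lifted points stay within the range of [es_lift]. *)
Lemma shadow n x y : d (iter n f x) y <= del ->
  exists2 x', iter n f x' = y & forall i, (i <= n)%N ->
    lam ^+ (n - i) * d (iter i f x) (iter i f x') <= d (iter n f x) y.
Proof.
elim: n x y => [|n IH] x y hy.
  by exists y => // i; rewrite leqn0 => /eqP ->; rewrite mul1r.
rewrite iterSr in hy *.
have [v hv hs] := IH _ _ hy.
have h1 := hs 0 (leq0n n); rewrite /= subn0 in h1.
have [x' hx' hd] : exists2 x', f x' = v & lam * d x x' <= d (f x) v.
  apply: (es_lift sys); apply: le_trans hy; apply: le_trans h1.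
  by rewrite ler_peMl// exprn_ege1// ltW.
exists x'; first by rewrite iterSr hx'.
case=> [_|i i_n]; last by rewrite !iterSr hx' subSS; apply: hs.
rewrite subn0 exprSr -mulrA; apply: le_trans h1.
by rewrite ler_pM2l ?exprn_gt0.
Qed.

Lemma shadow_tracks n x y : d (iter n f x) y <= del ->
  exists2 x', iter n f x' = y & tracks n x x'.
Proof.
move=> h; have [x' e hx'] := shadow h; exists x' => // i i_n.
apply: le_trans h; apply: le_trans (hx' i i_n).
by rewrite ler_peMl// exprn_ege1// ltW.
Qed.

(** Bounds every product of the factors 1 + c d(f^i x, f^i y) over an orbit
    segment along which the distance is at most del, since these distances
    are dominated by a geometric series. *)
Definition distortion : R := expR (c * (del / (lam - 1))).
Local Notation E := distortion.

Lemma distortion_gt0 : 0 < E. Proof. exact: expR_gt0. Qed.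

Lemma tracks_prod n x y : tracks n x y ->
  \prod_(i < n) (1 + c * d (iter i f x) (iter i f y)) <= E.
Proof.
move=> h; apply: (@le_trans _ _
    (\prod_(i < n) expR (c * d (iter i f x) (iter i f y)))).
  apply: ler_prod => i _; rewrite expR_ge1Dx andbT.
  by rewrite addr_ge0// mulr_ge0.
rewrite -expR_sum ler_expR -mulr_sumr ler_wpM2l//.
apply: (@le_trans _ _ (\sum_(i < n) del * (lam ^+ (n - i))^-1)).
  apply: ler_sum => i _; rewrite ler_pdivlMr ?exprn_gt0// mulrC.
  by apply: le_trans (tracks_contract h (ltnW (ltn_ord i))) (h _ _).
by rewrite -mulr_sumr ler_pM2l// geometric_tail.
Qed.

Lemma cocycle_distortion n x y : tracks n x y -> D n x <= E * D n y.
Proof.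
move=> h; rewrite mulrC; apply: le_trans (ler_wpM2l _ (tracks_prod h)).
  rewrite /cocycle -big_split /=; apply: ler_prod => i _.
  by rewrite (ltW (w_gt0 _))/= (es_w_dist sys)//; apply: h; apply: ltnW.
exact/ltW/cocycle_gt0.
Qed.

Lemma dist_iter_le n x y : tracks n x y ->
  d (iter n f x) (iter n f y) <= E * D n x * d x y.
Proof.
move=> h; have := tracks_prod h; rewrite -!mulrA => hE.
suff H : d (iter n f x) (iter n f y) <= D n x * d x y *
    \prod_(i < n) (1 + c * d (iter i f x) (iter i f y)).
  apply: le_trans H _; rewrite [leRHS]mulrC ler_wpM2l//.
  by rewrite mulr_ge0// ltW// cocycle_gt0.
elim: n h {hE} => [|n IH] h; first by rewrite cocycle0 big_ord0 mul1r mulr1.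
have hn : tracks n x y by move=> i i_n; apply: h; apply: leqW.
rewrite /cocycle 2!big_ord_recr /= -/(D n x).
apply: le_trans (es_upper sys (h n _)) _ => //.
rewrite !mulrA; apply: ler_wpM2r; first by rewrite addr_ge0// mulr_ge0.
have := ler_wpM2l (ltW (w_gt0 (iter n f x))) (IH hn).
lra.
Qed.

Lemma dist_le_iter n x y : tracks n x y ->
  D n x * d x y <= E * d (iter n f x) (iter n f y).
Proof.
move=> h; have := tracks_prod h => hE.
suff H : D n x * d x y <= d (iter n f x) (iter n f y) *
    \prod_(i < n) (1 + c * d (iter i f x) (iter i f y)).
  by apply: le_trans H _; rewrite [leRHS]mulrC ler_wpM2l.
elim: n h {hE} => [|n IH] h; first by rewrite cocycle0 big_ord0 mul1r mulr1.
have hn : tracks n x y by move=> i i_n; apply: h; apply: leqW.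
rewrite /cocycle 2!big_ord_recr /= -/(D n x) mulrAC.
apply: le_trans (ler_wpM2r (ltW (w_gt0 _)) (IH hn)) _.
have pr0 : 0 <= \prod_(i < n) (1 + c * d (iter i f x) (iter i f y)).
  by rewrite prodr_ge0// => i _; rewrite addr_ge0// mulr_ge0.
have := ler_wpM2r pr0 (es_lower sys (h n (leqnSn n))).
lra.
Qed.

Lemma tracks_eq n x y : tracks n x y -> iter n f x = iter n f y -> x = y.
Proof.
move=> h e; apply/(es_dist_eq0 sys); apply/eqP; rewrite eq_le d_ge0 andbT.
by have := tracks_contract_le (i := 0) h (leq0n n); rewrite e dxx; apply.
Qed.

Definition holder (phi : X -> R) (al H : R) := [/\ 0 < al, 0 <= H &
  forall x y, `|phi x - phi y| <= H * d x y `^ al].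

(** The constant that [birkhoff_tracks] obtains by summing the geometric series
    of the distances to the power al. *)
Definition holder_sum (al H : R) := H / (lam `^ al - 1).

Lemma holder_sum_ge0 al H : 0 < al -> 0 <= H -> 0 <= holder_sum al H.
Proof.
by move=> al0 H0; rewrite divr_ge0// subr_ge0 ltW// powR_gt1.
Qed.

Lemma birkhoff_tracks phi al H n x y : holder phi al H -> tracks n x y ->
  `|S phi n x - S phi n y| <=
    holder_sum al H * d (iter n f x) (iter n f y) `^ al.
Proof.
move=> [al0 H0 hphi] h; rewrite /birkhoff -sumrB.
apply: le_trans (ler_norm_sum _ _ _) _.
set dn := d (iter n f x) _.
have la1 : 1 < lam `^ al by rewrite powR_gt1.
apply: (@le_trans _ _ (\sum_(i < n)
   H * dn `^ al * ((lam `^ al) ^+ (n - i))^-1)).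
  apply: ler_sum => i _; apply: le_trans (hphi _ _) _; rewrite -mulrA.
  rewrite ler_wpM2l// ler_pdivlMr ?exprn_gt0 ?powR_gt0//.
  rewrite -powR_mulrn ?powR_ge0// -powRrM mulrC [al * _]mulrC.
  rewrite powRrM powR_mulrn ?(ltW lam_gt0)//.
  have hl := ltW (exprn_gt0 (n - i) lam_gt0).
  rewrite -powRM//; rewrite ge0_ler_powR ?nnegrE ?mulr_ge0 ?(ltW al0) ?/dn//.
  exact: tracks_contract h (ltnW (ltn_ord i)).
rewrite -mulr_sumr /holder_sum -[leRHS]mulrAC ler_wpM2l ?geometric_tail//.
by rewrite mulr_ge0 ?powR_ge0.
Qed.
End Expanding.

(** * Birkhoff sums of bounded oscillation are cohomologous to constants *)

Section Livsic.
Variables (R : realType) (X : choiceType) (d : X -> X -> R) (f : X -> X).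
Variables (w : X -> R) (lam L c del : R).
Hypothesis sys : expanding_system d f w lam L c del.

Local Notation S := (birkhoff f).

Let d_ge0 x y : 0 <= d x y := es_dist_ge0 sys x y.
Let d_sym x y : d x y = d y x := es_dist_sym sys x y.
Let dxx x : d x x = 0. Proof. exact/(es_dist_eq0 sys). Qed.
Let lam1 : 1 < lam := es_lam sys.
Let del0 : 0 < del := es_del sys.
Let lam_gt0 : 0 < lam. Proof. by move: lam1; lra. Qed.

Lemma birkhoff_mul (phi : X -> R) n A K p x :
  (forall y, `|S phi n y - A| <= K) ->
  `|S phi (p * n) x - A *+ p| <= K *+ p.
Proof.
move=> h; elim: p x => [|p IH] x.
  by rewrite mul0n birkhoff0 !mulr0n subrr normr0.
rewrite mulSn birkhoffD !mulrS opprD addrACA.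
by apply: le_trans (ler_normD _ _) _; rewrite lerD.
Qed.

(** The sums a_n at a fixed point are additive up to K, so (a_n - K) / n <=
    (a_p + K) / p for all n and p, as both sides can be compared with
    a_(np) / (np).  The constant m separates the two families of quotients. *)
Lemma birkhoff_mean (phi : X -> R) K (x0 : X) :
    (forall n x y, S phi n x - S phi n y <= K) ->
  exists m, forall n x, `|S phi n x - m *+ n| <= 2 * K.
Proof.
move=> hK; pose a n := S phi n x0.
have K0 : 0 <= K by have := hK 0 x0 x0; rewrite subrr.
have ha n y : `|S phi n y - a n| <= K.
  have := hK n y x0; have := hK n x0 y; rewrite /a ler_norml => h1 h2.
  by apply/andP; split; lra.
pose A := [set r | exists2 n, (0 < n)%N & r = (a n - K) / n%:R].
have key n p : (0 < n)%N -> (0 < p)%N -> (a n - K) / n%:R <= (a p + K) / p%:R.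
  move=> n0 p0; rewrite ler_pdivrMr ?ltr0n// mulrAC ler_pdivlMr ?ltr0n//.
  have := birkhoff_mul p x0 (ha n); have := birkhoff_mul n x0 (ha p).
  rewrite mulnC -[a n *+ p]mulr_natr -[K *+ p]mulr_natr -[a p *+ n]mulr_natr.
  rewrite -[K *+ n]mulr_natr !ler_norml => /andP[_ h1] /andP[h2 _].
  lra.
have A0 : A !=set0 by exists ((a 1 - K) / 1), 1%N.
have Aub p : (0 < p)%N -> ubound A ((a p + K) / p%:R).
  by move=> p0 _ [n n0 ->]; apply: key.
exists (sup A) => -[|n] x.
  by rewrite birkhoff0 mulr0n subrr normr0 mulr_ge0.
have h1 : (a n.+1 - K) / n.+1%:R <= sup A.
  by apply: ub_le_sup; [exists ((a 1 + K) / 1); apply: Aub|exists n.+1].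
have h2 : sup A <= (a n.+1 + K) / n.+1%:R by apply: ge_sup => //; apply: Aub.
rewrite ler_pdivrMr ?ltr0n// in h1; rewrite ler_pdivlMr ?ltr0n// in h2.
have := ha n.+1 x; rewrite -mulr_natr !ler_norml => /andP[h3 h4].
apply/andP; split; lra.
Qed.

(** A transfer function is obtained without periodic orbits or a dense orbit.
    Put u(x) = sup of S_n psi(y) over all n and all y with f^n y = x; lifting
    makes u Hölder, and u(f x) >= u(x) + psi(x).  The defect
    h(x) = u(f x) - u(x) - psi(x) is nonnegative and its Birkhoff sums are
    bounded.  If h were positive at some point, then by exactness an orbit
    could be made to visit a neighbourhood of this point arbitrarily often. *)
Lemma bounded_birkhoff_coboundary psi al H B :
    holder d psi al H -> (forall n x, `|S psi n x| <= B) ->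
  exists2 u : X -> R,
    forall x y, d x y <= del ->
      `|u x - u y| <= holder_sum lam al H * d x y `^ al &
    forall x, psi x = u (f x) - u x.
Proof.
move=> hpsi hB; have [al0 H0 hpsi'] := hpsi.
set C := holder_sum lam al H.
have C0 : 0 <= C by apply: (holder_sum_ge0 sys).
pose U x := [set r | exists2 n, exists2 y, iter n f y = x & r = S psi n y &
  True].
have UP n y : U (iter n f y) (S psi n y) by exists n => //; exists y.
have U0 x : U x !=set0 by exists (S psi 0 x); apply: (UP 0).
have Uub x : ubound (U x) B.
  by move=> _ [n [y _ ->] _]; apply: le_trans (ler_norm _) (hB _ _).
pose u x := sup (U x).
have u_ge n y : S psi n y <= u (iter n f y).
  by apply: ub_le_sup; [exists B; apply: Uub|apply: UP].
have u_le x b : (forall n y, iter n f y = x -> S psi n y <= b) -> u x <= b.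
  by move=> h; apply: ge_sup => // _ [n [y e ->] _]; apply: h.
have uB x : `|u x| <= B.
  rewrite ler_norml; apply/andP; split.
    apply: le_trans (u_ge 0 x); rewrite birkhoff0 oppr_le0.
    exact: le_trans (normr_ge0 _) (hB 0 x).
  by apply: u_le => n y _; apply: le_trans (ler_norm _) (hB _ _).
have u_hold1 x y : d x y <= del -> u x - u y <= C * d x y `^ al.
  move=> hxy; rewrite lerBlDr; apply: u_le => n z zx.
  have [|z' z'y hz'] := shadow sys (n := n) (x := z) (y := y).
    by rewrite zx.
  have tr : tracks d f del n z z'.
    move=> i i_n; apply: le_trans hxy; rewrite -zx; apply: le_trans (hz' _ i_n).
    by rewrite ler_peMl// exprn_ege1// ltW.
  have := birkhoff_tracks sys hpsi tr; rewrite zx z'y -/C => h.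
  rewrite -lerBlDr; apply: le_trans h; apply: le_trans _ (ler_norm _).
  by rewrite lerB// -z'y.
have u_hold x y : d x y <= del -> `|u x - u y| <= C * d x y `^ al.
  move=> hxy; rewrite ler_norml lerNl opprB u_hold1// andbT.
  by rewrite d_sym u_hold1// d_sym.
exists u => //.
pose h x := u (f x) - u x - psi x.
have h_ge0 x : 0 <= h x.
  rewrite /h -addrA -opprD subr_ge0 -lerBrDr; apply: u_le => n y yx.
  rewrite lerBrDr -yx; have := u_ge n.+1 y.
  by rewrite -[n.+1]addn1 birkhoffD birkhoff1 addn1.
have hsum n x : S h n x = u (iter n f x) - u x - S psi n x.
  elim: n => [|n IH]; first by rewrite !birkhoff0 !subrr.
  by rewrite -[n.+1]addn1 !birkhoffD IH !birkhoff1 addn1 /= /h; ring.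
have hsum_le n x : S h n x <= 3 * B.
  rewrite hsum; have := hB n x; have := uB x; have := uB (iter n f x).
  rewrite !ler_norml => /andP[? ?] /andP[? ?] /andP[? ?]; lra.
suff h0 x : h x = 0.
  by move=> x; have := h0 x; rewrite /h => /eqP; rewrite subr_eq0 => /eqP.
apply/eqP; rewrite eq_le h_ge0 andbT leNgt; apply/negP => hx.
have [r r0 hr] : exists2 r, 0 < r & forall y, d x y <= r -> h x / 2 <= h y.
  have Lx : 1 < L.
    by apply: lt_le_trans lam1 (le_trans (es_w_ge sys x) (es_w_le sys x)).
  have L0 : 0 < L by lra.
  pose q := C * L `^ al + C + H + 1.
  have q0 : 0 < q by rewrite ltr_wpDl// !addr_ge0// mulr_ge0// powR_ge0.
  pose r := Num.min (del / L) ((h x / 2 / q) `^ al^-1).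
  have hq0 : 0 < h x / 2 / q by rewrite !divr_gt0.
  have r_del : r <= del / L by rewrite ge_min lexx.
  have r_hq : r <= (h x / 2 / q) `^ al^-1 by rewrite ge_min lexx orbT.
  have r0 : 0 < r by rewrite lt_min divr_gt0//= powR_gt0.
  have r_al : q * r `^ al <= h x / 2.
    rewrite mulrC -ler_pdivlMr//.
    have -> : h x / 2 / q = ((h x / 2 / q) `^ al^-1) `^ al.
      by rewrite -powRrM mulVf ?lt0r_neq0// powRr1 ?(ltW hq0).
    by rewrite ge0_ler_powR ?nnegrE ?powR_ge0 ?(ltW al0) ?(ltW r0).
  exists r => // y xy.
  have hd : d (f x) (f y) <= L * r.
    by apply: le_trans (es_lipschitz sys _ _) _; rewrite ler_pM2l.
  have r_del' : L * r <= del by rewrite mulrC -ler_pdivlMr.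
  have xy' : d x y <= del.
    by apply: le_trans xy (le_trans r_del _); rewrite ler_pdivrMr//
      ler_peMr ?ltW.
  have mono s t : 0 <= s -> s <= t -> s `^ al <= t `^ al.
    by move=> s0 st; rewrite ge0_ler_powR ?nnegrE ?(ltW al0)// (le_trans s0).
  have h1 := u_hold _ _ (le_trans hd r_del'); have h2 := u_hold _ _ xy'.
  have h3 := hpsi' x y.
  have m1 := ler_wpM2l C0 (mono _ _ (d_ge0 _ _) hd).
  have m2 := ler_wpM2l C0 (mono _ _ (d_ge0 _ _) xy).
  have m3 := ler_wpM2l H0 (mono _ _ (d_ge0 _ _) xy).
  rewrite powRM ?(ltW L0) ?(ltW r0)// in m1.
  have ral0 := powR_ge0 r al.
  move: h1 h2 h3; rewrite !ler_norml /q in r_al *.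
  move=> /andP[_ h1] /andP[h2 _] /andP[h3 _].
  rewrite /h in r_al *; lra.
have [n n0 hn] := es_exact sys r0.
(* Orbits that return to the ball about x every n steps, built backwards. *)
have visits m : exists2 z, d x z <= r & (h x / 2) *+ m <= S h (m * n) z.
  elim: m => [|m [z xz hz]].
    by exists x; rewrite ?dxx ?(ltW r0)// mulr0n mul0n birkhoff0.
  have [y xy yz] := hn x z; exists y => //.
  rewrite mulSn birkhoffD yz mulrS lerD//; apply: le_trans (hr _ xy) _.
  rewrite -(subnKC n0) birkhoffD birkhoff1 lerDl /birkhoff.
  by rewrite sumr_ge0.
have [z _] := visits (Num.truncn (3 * B / (h x / 2))).+1.
apply/negP; rewrite -ltNge; apply: le_lt_trans (hsum_le _ _) _.
by rewrite -[ltRHS]mulr_natl -ltr_pdivrMr ?truncnS_gt// divr_gt0.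
Qed.

(** Unlike continuity, a Hölder bound for u on pairs of points at distance at
    most del needs no topology on X. *)
Definition cohomologous_const (phi : X -> R) :=
  exists m, exists2 u : X -> R,
    exists al H, [/\ 0 < al, 0 <= H & forall x y, d x y <= del ->
      `|u x - u y| <= H * d x y `^ al] &
    forall x, phi x = m + u x - u (f x).

Lemma bounded_oscillation_cohomologous (phi : X -> R) al H K (x0 : X) :
    holder d phi al H -> (forall n x y, S phi n x - S phi n y <= K) ->
  cohomologous_const phi.
Proof.
move=> [al0 H0 hphi] /(birkhoff_mean x0)[m hm].
have hpsi : holder d (fun x => phi x - m) al H.
  by split=> // x y; rewrite opprB addrA subrK.
have [|u hu e] := bounded_birkhoff_coboundary (B := 2 * K) hpsi.
  by move=> n x; rewrite birkhoffB_const.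
exists m, (fun x => - u x).
  exists al, (holder_sum lam al H); split=> //.
    exact: (holder_sum_ge0 sys).
  by move=> x y /hu; rewrite -opprB normrN opprK addrC.
by move=> x; have := e x; lra.
Qed.

End Livsic.

(** * Orbit segments returning to a base point *)

Section Blocks.
Variables (R : realType) (X : choiceType) (d : X -> X -> R) (f : X -> X).
Variables (w : X -> R) (lam L c del : R).
Hypothesis sys : expanding_system d f w lam L c del.

Local Notation D := (cocycle f w).
Local Notation S := (birkhoff f).
Local Notation E := (distortion lam c del).

Let d_ge0 x y : 0 <= d x y := es_dist_ge0 sys x y.
Let d_sym x y : d x y = d y x := es_dist_sym sys x y.
Let d_tri y x z : d x z <= d x y + d y z := es_dist_triangle sys y x z.
Let dxx x : d x x = 0. Proof. exact/(es_dist_eq0 sys). Qed.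
Let lam1 : 1 < lam := es_lam sys.
Let del0 : 0 < del := es_del sys.
Let lam_gt0 : 0 < lam. Proof. by move: lam1; lra. Qed.

Let L0 (x : X) : 0 < L.
Proof. by apply: lt_le_trans (le_trans (es_w_ge sys x) (es_w_le sys x)). Qed.

Lemma birkhoff_oscillation (phi : X -> R) al H : holder d phi al H ->
  exists K, forall n x y, S phi n x - S phi n y <= K *+ n.
Proof.
move=> [al0 H0 hphi]; have [M hM] := es_bounded sys.
exists (H * M `^ al) => n x y; rewrite /birkhoff -sumrB.
rewrite -[n in X in _ <= X]card_ord -sumr_const; apply: ler_sum => i _.
apply: le_trans (ler_norm _) (le_trans (hphi _ _) _).
rewrite ler_wpM2l// ge0_ler_powR ?nnegrE ?(ltW al0)//.
exact: le_trans (d_ge0 x x) (hM x x).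
Qed.

(** Since phi is not cohomologous to a constant, two orbit segments of equal
    length have sums as far apart as desired.  By exactness each of them can be
    preceded and followed by k steps so as to start near a and end at a, which
    changes the sums by a bounded amount only.  A loop is then repeated by
    pulling back along it, which costs at most K per turn. *)
Lemma returning_loops (phi : X -> R) al H (a : X) rho :
    0 < rho -> rho <= del -> holder d phi al H ->
      ~ cohomologous_const d f del phi ->
  exists2 P, (0 < P)%N & forall m, exists z1 z2,
    [/\ d a z1 <= rho, d a z2 <= rho, iter (m * P) f z1 = a,
        iter (m * P) f z2 = a & m%:R <= S phi (m * P) z1 - S phi (m * P) z2].
Proof.
move=> rho0 rho_del hphi ncoh.
have [al0 H0 _] := hphi.
have [K1 hK1] := birkhoff_oscillation hphi.
set K := holder_sum lam al H * del `^ al.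
have hK n x y : tracks d f del n x y -> `|S phi n x - S phi n y| <= K.
  move=> tr; apply: le_trans (birkhoff_tracks sys hphi tr) _.
  rewrite ler_wpM2l ?(holder_sum_ge0 sys)//.
  by rewrite ge0_ler_powR ?nnegrE ?(ltW al0) ?(ltW del0)//; apply: tr.
(* A loop that starts within rho' of a, shadowed so as to end within rho of a,
   starts within rho' + rho / lam = rho of a. *)
set rho' := (1 - lam^-1) * rho.
have lamV1 : lam^-1 < 1 by rewrite invf_lt1.
have lamV0 : 0 < lam^-1 by rewrite invr_gt0.
have rho'0 : 0 < rho' by rewrite mulr_gt0// subr_gt0.
have rho'_del : rho' <= del by apply: le_trans rho_del; rewrite /rho'; nra.
have [k k0 hk] := es_exact sys rho'0.
have connect n x : exists z, exists2 x1, tracks d f del n x x1 &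
    exists b, [/\ d a z <= rho', iter (k + (n + k)) f z = a &
      S phi (k + (n + k)) z = S phi k z + (S phi n x1 + S phi k b)].
  have [b xb ba] := hk (iter n f x) a.
  have [x1 x1b tr] := shadow_tracks sys (le_trans xb rho'_del).
  have [z az zx1] := hk a x1.
  exists z, x1 => //; exists b; split=> //.
    by rewrite addnC iterD zx1 addnC iterD x1b.
  by rewrite !birkhoffD zx1 x1b.
have [n [x [y hxy]]] : exists n x y,
    1 + 4 * K + 2 * (K1 *+ k) < S phi n x - S phi n y.
  apply: contrapT => hno; apply: ncoh.
  apply: (bounded_oscillation_cohomologous sys (K :=
    1 + 4 * K + 2 * (K1 *+ k)) a hphi).
  by move=> n x y; rewrite leNgt; apply/negP => h; apply: hno; exists n, x, y.
set P := (k + (n + k))%N.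
have P0 : (0 < P)%N by rewrite addn_gt0 k0.
have [zu [x1 trx [b [azu zua Szu]]]] := connect n x.
have [zv [y1 try [b' [azv zva Szv]]]] := connect n y.
have gap : 1 + 2 * K <= S phi P zu - S phi P zv.
  rewrite Szu Szv.
  have := hK _ _ _ trx; have := hK _ _ _ try.
  have := hK1 k zv zu; have := hK1 k b' b.
  rewrite !ler_norml => h1 h2 /andP[h3 h4] /andP[h5 h6].
  lra.
have pull z z' : d a z <= rho' -> iter P f z = a -> d a z' <= rho ->
    exists2 z'', d a z'' <= rho &
      iter P f z'' = z' /\ `|S phi P z - S phi P z''| <= K.
  move=> az za az'.
  have hz' : d (iter P f z) z' <= del by rewrite za (le_trans az').
  have [z'' e tr] := shadow_tracks sys hz'.
  exists z''; last by split=> //; apply: hK.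
  apply: le_trans (d_tri z _ _) _.
  have := tracks_contract sys (i := 0) tr (leq0n _).
  rewrite /= za e subn0 => h.
  have h' : lam * d z z'' <= rho.
    apply: le_trans az'; apply: le_trans h.
    by rewrite ler_wpM2r// -[leLHS]expr1 ler_weXn2l// ltW.
  have h2 : d z z'' <= lam^-1 * rho by rewrite mulrC ler_pdivlMr// mulrC.
  move: az; rewrite /rho'; lra.
exists P => //; elim=> [|m [z1 [z2 [az1 az2 z1a z2a hm]]]].
  exists a, a; rewrite mul0n !dxx !birkhoff0 subrr; split=> //; exact: ltW.
have [u1 au1 [u1z Su1]] := pull _ _ azu zua az1.
have [u2 au2 [u2z Su2]] := pull _ _ azv zva az2.
exists u1, u2; split=> //; rewrite mulSn.
- by rewrite addnC iterD u1z.
- by rewrite addnC iterD u2z.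
rewrite !(birkhoffD f phi P) u1z u2z -nat1r.
move: Su1 Su2; rewrite !ler_norml => /andP[? ?] /andP[? ?]; lra.
Qed.

Lemma finite_preimages n a :
  exists2 s : seq X, uniq s & forall y, (y \in s) = (iter n f y == a).
Proof.
suff [s hs] : exists s : seq X, forall y, iter n f y = a -> y \in s.
  exists (undup [seq y <- s | iter n f y == a]); first exact: undup_uniq.
  move=> y; rewrite mem_undup mem_filter; case: eqP => //= e.
  by rewrite hs.
elim: n => [|n [s hs]].
  by exists [:: a] => y /= ->; rewrite inE.
have [g hg] := choice (es_finite sys).
exists (flatten (map g s)) => y; rewrite iterSr => /hs hy.
by apply/flattenP; exists (g (f y)); [exact: map_f|exact: hg].
Qed.

Definition cover_bound (t h0 eps : R) := forall (s : seq X) (r : X -> R),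
  (forall y, 0 < r y <= eps) -> (forall x, exists2 y, y \in s & d x y <= r y) ->
  h0 <= \sum_(y <- s) r y `^ t.

(** By exactness, every orbit segment of length n is shadowed by one that
    reaches a after k0 more steps; so balls about the points of
    f^-(n + k0)(a), of radius comparable to the inverse derivative, cover X.
    Hence the sum with exponent t' is bounded from below, and lowering the
    exponent to t gains a factor that grows exponentially with n.  Going back
    k' more steps brings the points into the ball of radius rho about a. *)
Lemma many_returns (a : X) rho t t' h0 eps B :
    0 < rho -> 0 < t -> t < t' -> 0 < h0 -> 0 < eps -> cover_bound t' h0 eps ->
  exists N, exists Z : seq X,
    [/\ (0 < N)%N, uniq Z,
        forall z, z \in Z -> d a z <= rho /\ iter N f z = a &
        B <= \sum_(z <- Z) D N z `^ (- t)].
Proof.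
move=> rho0 t0 tt' h00 eps0 hcov.
have L_gt0 := L0 a; have E0 : 0 < E := distortion_gt0 lam c del.
have Dpos n x := cocycle_gt0 sys n x.
have [k0 _ hk0] := es_exact sys del0.
have [k' k'0 hk'] := es_exact sys rho0.
set A := E * del * L ^+ k0.
have A0 : 0 < A by rewrite !mulr_gt0// exprn_gt0.
set K3 := A `^ t'; have K30 : 0 < K3 by rewrite powR_gt0.
set K4 := (L ^+ k') `^ (- t); have K40 : 0 < K4 by rewrite powR_gt0// exprn_gt0.
have q1 : 1 < lam `^ (t' - t) by rewrite powR_gt1// subr_gt0.
have [n1 hn1] := expr_large (A / eps) lam1.
have [n2 hn2] := expr_large (B / (K4 * (h0 / K3))) q1.
set n := maxn n1 n2; set M := (n + k0)%N.
have [s us hs] := finite_preimages M a.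
have sum_t' : h0 / K3 <= \sum_(y <- s) D M y `^ (- t').
  rewrite ler_pdivrMr// mulrC mulr_sumr.
  under eq_bigr => y _.
    rewrite powRN -powR_inv1 ?powR_ge0// -powRrM mulrN1.
    rewrite -[- t']mulN1r powRrM powR_inv1 ?(ltW (Dpos _ _))//.
    rewrite -powRM ?invr_ge0 ?(ltW (Dpos _ _)) ?(ltW A0)//; over.
  apply: hcov => [y|x].
    rewrite divr_gt0//= ler_pdivrMr// mulrC -ler_pdivrMr//.
    apply: le_trans (hn1 M _) (cocycle_ge sys M y).
    exact: leq_trans (leq_maxl _ _) (leq_addr _ _).
  have [b xb ba] := hk0 (iter n f x) a.
  have [x' x'b tr] := shadow_tracks sys xb.
  exists x'; first by rewrite hs /M addnC iterD x'b ba.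
  have := dist_le_iter sys (tracks_sym sys tr).
  rewrite x'b d_sym [d b _]d_sym => h.
  rewrite ler_pdivlMr// /M cocycleD x'b.
  apply: (@le_trans _ _ (D n x' * d x x' * L ^+ k0)).
    by rewrite mulrCA -mulrA ler_pM2l// ler_wpM2l// (cocycle_le sys).
  rewrite /A ler_wpM2r ?exprn_ge0 ?(ltW L_gt0)//.
  by apply: le_trans h _; rewrite ler_pM2l.
have [pre hpre] : exists pre, forall y, d a (pre y) <= rho /\ iter k' f (pre
  y) = y.
  have h y : exists z, d a z <= rho /\ iter k' f z = y.
    by have [z] := hk' a y; exists z.
  by have [g hg] := choice h; exists g.
have lam_n m : 0 < lam ^+ m by rewrite exprn_gt0.
have pre_inj : injective pre.
  by move=> y1 y2 e; have [_ <-] := hpre y1; rewrite e; have [_] := hpre y2.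
exists (k' + M)%N, (map pre s); split.
- by rewrite addn_gt0 k'0.
- by rewrite map_inj_uniq.
- move=> _ /mapP[y ys ->]; have [h1 h2] := hpre y; split=> //.
  by rewrite addnC iterD h2; apply/eqP; rewrite -hs.
rewrite big_map.
apply: (@le_trans _ _ (K4 * (lam ^+ M) `^ (t' - t) *
    \sum_(y <- s) D M y `^ (- t'))).
  rewrite (powR_expr _ M lam_gt0); apply: (@le_trans _ _
      (K4 * (lam `^ (t' - t)) ^+ M * (h0 / K3))).
    rewrite mulrAC mulrC -ler_pdivrMr ?mulr_gt0 ?divr_gt0 ?invr_gt0//.
    by apply: hn2; exact: leq_trans (leq_maxr _ _) (leq_addr _ _).
  by rewrite ler_wpM2l// mulr_ge0 ?exprn_ge0 ?powR_ge0 ?(ltW K40).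
rewrite mulr_sumr; apply: ler_sum => y _.
have [h1 h2] := hpre y.
rewrite cocycleD h2 powRM ?(ltW (Dpos _ _))// -mulrA.
have anti u v : 0 < u -> u <= v -> v `^ (- t) <= u `^ (- t).
  move=> u0 uv; have v0 := lt_le_trans u0 uv.
  rewrite !powRN lef_pV2 ?posrE ?powR_gt0//.
  by rewrite ge0_ler_powR ?nnegrE ?(ltW t0) ?(ltW u0) ?(ltW v0).
apply: ler_pM; rewrite ?powR_ge0 ?mulr_ge0 ?powR_ge0//.
  by apply: anti => //; apply: (cocycle_le sys).
have -> : D M y `^ (- t) = D M y `^ (t' - t) * D M y `^ (- t').
  rewrite -powRD; first by congr (_ `^ _); ring.
  by apply/implyP => _; rewrite gt_eqF.
rewrite ler_wpM2r ?powR_ge0// ge0_ler_powR ?nnegrE ?subr_ge0 ?(ltW tt')//.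
- exact: ltW.
- exact: ltW.
exact: (cocycle_ge sys).
Qed.
End Blocks.

(** * Mass distribution on trees *)

Section MassDistribution.
Variables (R : realType) (Nd : Type) (X : eqType).

Lemma sum_at_most_one (s : seq X) (F : X -> R) b :
    uniq s -> 0 <= b -> (forall z, z \in s -> F z <= b) ->
    (forall z z', z \in s -> z' \in s -> z != z' -> F z = 0 \/ F z' = 0) ->
  \sum_(z <- s) F z <= b.
Proof.
move=> us b0 Fb F1; have [/allP h|] := boolP (all (fun z => F z == 0) s).
  by rewrite big_seq big1// => z zs; apply/eqP/h.
rewrite -has_predC => /hasP[z zs /= Fz].
rewrite (bigD1_seq z)//= big_seq_cond big1 ?addr0 ?Fb// => z' /andP[z's zz'].
by case: (F1 _ _ zs z's); rewrite 1?eq_sym// => e; rewrite e eqxx in Fz.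
Qed.

Variables (inv : Nd -> Prop) (digits : Nd -> seq X) (child : Nd -> X -> Nd).
Variables (mass : Nd -> R) (meets : nat -> Nd -> Prop) (a : nat -> R).
Variables (s : R) (root : Nd).
Hypothesis inv_root : inv root.
Hypothesis inv_child : forall v z, inv v -> z \in digits v -> inv (child v z).
Hypothesis mass_gt0 : forall v, inv v -> 0 < mass v.
Hypothesis digits_uniq : forall v, inv v -> uniq (digits v).
Hypothesis mass_sum : forall v, inv v ->
  \sum_(z <- digits v) mass (child v z) = mass v.
Hypothesis meets_child : forall j v z, inv v -> z \in digits v ->
  meets j (child v z) -> meets j v.
Hypothesis meets_two : forall j v z z', inv v -> z \in digits v ->
  z' \in digits v -> z != z' -> meets j (child v z) -> meets j (child v z') ->
  mass v <= a j.
Hypothesis a_gt0 : forall j, 0 < a j.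
Hypothesis s1 : s < 1.
Hypothesis sum_a : forall n, \sum_(j < n) a j <= s * mass root.

(** The share of the mass of v claimed by the j-th set. *)
Let m j v := if `[< meets j v >] then Num.min (mass v) (a j) else 0.
Let good v := inv v /\ forall n, \sum_(j < n) m j v <= s * mass v.

Let m_ge0 j v : inv v -> 0 <= m j v.
Proof.
by move=> iv; rewrite /m; case: ifP => // _; rewrite le_min !ltW ?mass_gt0.
Qed.

(** If a j is less than the mass of v, then the j-th set meets at most one
    child, and that child claims at most a j.  Otherwise the j-th set claims the
    whole mass of v. *)
Let m_super j v : inv v -> \sum_(z <- digits v) m j (child v z) <= m j v.
Proof.
move=> iv; have ic z : z \in digits v -> inv (child v z) by apply: inv_child.
have [jv|jv] := asboolP (meets j v); last first.
  rewrite big_seq big1 ?m_ge0// => z zv; rewrite /m ifF//.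
  by apply/negbTE/asboolPn => h; apply: jv; apply: meets_child h.
rewrite /m (asboolT jv); have [va|av] := leP (mass v) (a j).
  rewrite -[leRHS]mass_sum// big_seq [leRHS]big_seq.
  apply: ler_sum => z zv; case: ifP => _; first by rewrite ge_min lexx.
  by apply/ltW/mass_gt0/ic.
apply: sum_at_most_one; [exact: digits_uniq|exact: ltW| |].
  by move=> z zv; case: ifP => _; [rewrite ge_min lexx orbT|exact: ltW].
move=> z z' zv z'v zz'; case: asboolP => h; last by left.
case: asboolP => h'; last by right.
by have := meets_two iv zv z'v zz' h h'; rewrite leNgt av.
Qed.

Let good_child v : good v -> exists2 z, z \in digits v & good (child v z).
Proof.
move=> [iv gv]; apply: contrapT => hno.
have bad z : exists n, z \in digits v ->
    s * mass (child v z) < \sum_(j < n) m j (child v z).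
  have [zv|zv] := boolP (z \in digits v); last by exists 0.
  apply: contrapT => hn; apply: hno; exists z => //; split.
    exact: inv_child.
  by move=> n; rewrite leNgt; apply/negP => h; apply: hn; exists n.
have [N hN] := choice bad.
pose n := \max_(z <- digits v) N z.
have hn z : z \in digits v -> s * mass (child v z) < \sum_(j < n) m j (child v
  z).
  move=> zv; apply: lt_le_trans (hN z zv) _.
  have Nn : (N z <= n)%N by rewrite /n (big_rem z)//= leq_maxl.
  rewrite -(subnKC Nn) big_split_ord/= lerDl sumr_ge0// => i _.
  by apply: m_ge0; apply: inv_child.
have ne : digits v <> [::].
  by move=> e; have := mass_gt0 iv; rewrite -mass_sum// e big_nil ltxx.
suff : s * mass v < \sum_(j < n) m j v.
  by rewrite ltNge gv.
apply: (@lt_le_trans _ _ (\sum_(z <- digits v) \sum_(j < n) m j (child v z))).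
  rewrite -mass_sum// mulr_sumr big_seq [ltRHS]big_seq.
  case: (digits v) ne hn => // z0 s0 _ hn.
  apply: ltr_sum => //; last first.
  by apply/hasP; exists z0; rewrite inE eqxx.
by rewrite exchange_big/=; apply: ler_sum => j _; apply: m_super.
Qed.

(** The sets never claim more than the fraction s < 1 of the mass of the nodes
    on the path: a node that is good in this sense has a good child, as the
    claims are superadditive.  A set that meets a good node v claims
    min(mass v, a j) < mass v. *)
Lemma tree_escape : exists path : nat -> Nd, [/\ path 0 = root,
   (forall n, inv (path n)),
   (forall n, exists2 z, z \in digits (path n) & path n.+1 = child (path n) z) &
   forall n j, meets j (path n) -> a j < mass (path n)].
Proof.
have good_root : good root.
  split=> // n; apply: le_trans (sum_a n); apply: ler_sum => j _.
  by rewrite /m; case: ifP => _; [rewrite ge_min lexx orbT|exact: ltW].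
have step v : exists v', good v ->
    good v' /\ exists2 z, z \in digits v & v' = child v z.
  have [gv|ngv] := pselect (good v); last by exists v.
  by have [z zv gz] := good_child gv; exists (child v z) => _; split=> //;
    exists z.
have [next hnext] := choice step.
pose path n := iter n next root.
have gp n : good (path n).
  by elim: n => //= n IH; have [] := hnext _ IH.
exists path; split=> //.
- by move=> n; have [] := gp n.
- by move=> n; have [_] := hnext _ (gp n).
move=> n j hj; have [iv gv] := gp n.
have : m j (path n) < mass (path n).
  apply: (@le_lt_trans _ _ (s * mass (path n))); last first.
    by rewrite gtr_pMl// mass_gt0.
  apply: le_trans (gv j.+1); rewrite big_ord_recr /= lerDr.
  by apply: sumr_ge0 => i _; apply: m_ge0.
by rewrite /m (asboolT hj) gt_min ltxx.
Qed.

End MassDistribution.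

(** * Irregular points outside a thin cover *)

(** The orbit segment of length [time] that starts at [base].  The function
    whose average is disturbed next has index [logn 2 (stage v)]; every
    natural number is the 2-adic valuation of arbitrarily large stages. *)
Record node (R : realType) (X : Type) := Node {
  time : nat; base : X; stage : nat; mass : R }.

(** T1 and T2 are the times before and after a filler, A and B the sums at the
    nodes, X1 and X2 the sums at the limit point.  The left side of the first
    hypothesis is at least 1 / (8 C), and 48 K C <= T1 makes the error 3 K / T1
    at most half of this. *)
Lemma average_gap (R : realType) (T1 T2 m C K A B X1 X2 : R) :
    m / (2 * T2) <= `|A / T1 - B / T2| ->
    `|X1 - A| <= K -> `|X2 - B| <= 2 * K ->
    0 < T1 -> 0 < C -> T1 <= T2 -> T2 <= 2 * T1 -> T1 <= 2 * C * m ->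
    48 * K * C <= T1 ->
  (16 * C)^-1 <= `|X1 / T1 - X2 / T2|.
Proof.
move=> hm hA hB T10 C0 T12 T21 mC KC.
have T20 : 0 < T2 := lt_le_trans T10 T12.
have K0 : 0 <= K := le_trans (normr_ge0 _) hA.
set s := (48 * C)^-1.
have s1 : `|X1 / T1 - A / T1| <= s.
  rewrite -mulrBl normrM normfV (gtr0_norm T10) ler_pdivrMr//.
  by apply: le_trans hA _; rewrite /s mulrC ler_pdivlMr ?mulr_gt0//
    mulrCA mulrA.
have s2 : `|X2 / T2 - B / T2| <= 2 * s.
  rewrite -mulrBl normrM normfV (gtr0_norm T20) ler_pdivrMr//.
  apply: le_trans hB _; rewrite -mulrA ler_pM2l// /s mulrC.
  rewrite ler_pdivlMr ?mulr_gt0// mulrCA mulrA; exact: le_trans KC T12.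
have s3 : 6 * s <= m / (2 * T2).
  rewrite ler_pdivlMr ?mulr_gt0// /s.
  rewrite mulrAC ler_pdivrMr ?mulr_gt0//; lra.
have -> : (16 * C)^-1 = 3 * s by rewrite /s; field; rewrite gt_eqF.
have := ler_distD (X1 / T1) (A / T1) (B / T2).
have := ler_distD (X2 / T2) (X1 / T1) (B / T2).
rewrite distrC in s1; lra.
Qed.

Definition not_cauchy (R : realType) (A : nat -> R) :=
  exists2 eps, 0 < eps & forall n0, exists T1 T2,
    [/\ (n0 <= T1)%N, (n0 <= T2)%N & eps <= `|A T1 - A T2|].

Section Irregular.
Variables (R : realType) (X : choiceType) (d : X -> X -> R) (f : X -> X).
Variables (w : X -> R) (lam L c del : R).
Hypothesis sys : expanding_system d f w lam L c del.

Local Notation D := (cocycle f w).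
Local Notation S := (birkhoff f).
Local Notation E := (distortion lam c del).

Let d_ge0 x y : 0 <= d x y := es_dist_ge0 sys x y.
Let d_sym x y : d x y = d y x := es_dist_sym sys x y.
Let d_tri y x z : d x z <= d x y + d y z := es_dist_triangle sys y x z.
Let dxx x : d x x = 0. Proof. exact/(es_dist_eq0 sys). Qed.
Let lam1 : 1 < lam := es_lam sys.
Let del0 : 0 < del := es_del sys.
Let lam_gt0 : 0 < lam. Proof. by move: lam1; lra. Qed.

Let rad : R := del / 3.
Let rho : R := (1 - lam^-1) * rad.

Variables (a : X) (t : R).
Hypothesis t0 : 0 < t.
Variables (N : nat) (Z : seq X).
Hypothesis N0 : (0 < N)%N.
Hypothesis Z_uniq : uniq Z.
Hypothesis Z_return : forall z, z \in Z -> d a z <= rho /\ iter N f z = a.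
Let W := \sum_(z <- Z) D N z `^ (- t).
Hypothesis W_large : 2 * L `^ t * E `^ t <= W.
Variables (phi : nat -> X -> R) (al H : nat -> R).
Hypothesis phi_holder : forall k, holder d (phi k) (al k) (H k).
Variables (P : nat -> nat) (z1 z2 : nat -> nat -> X).
Hypothesis P0 : forall k, (0 < P k)%N.
Hypothesis loops : forall k m,
  [/\ d a (z1 k m) <= rho, d a (z2 k m) <= rho,
      iter (m * P k) f (z1 k m) = a, iter (m * P k) f (z2 k m) = a &
      m%:R <= S (phi k) (m * P k) (z1 k m) - S (phi k) (m * P k) (z2 k m)].

Local Notation node := (node R X).

(** Chosen such that the filler is about T / N steps long, where T is the
    elapsed time: for fixed k its relative length is bounded from below as
    soon as there is one copy, while its cost, at most (L^t)^(T / N), is less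
    than the gain of T / N free steps. *)
Definition filler_count (v : node) := (time v %/ (N * P (logn 2 (stage v))))%N.

Definition filler_length (v : node) :=
  (filler_count v * P (logn 2 (stage v)))%N.

(** The last condition says that the mass stays below the inverse derivative to
    the power t even if a filler loses the worst possible factor. *)
Definition ready (v : node) :=
  [&& (0 < filler_count v)%N, (stage v <= time v)%N &
    mass v * D (time v) (base v) `^ t * E `^ t * (L `^ t) ^+ filler_length v
      <= 1].

Definition shifts_average (v : node) (z : X) :=
  let k := logn 2 (stage v) in
  let A := S (phi k) (time v) (base v) in
  let T2 := (time v + filler_length v)%N in
  (filler_count v)%:R / (2 * T2%:R) <=
  `|A / (time v)%:R - (A + S (phi k) (filler_length v) z) / T2%:R|.

(** Of two loops whose sums differ by m, at least one moves the average by half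
    of the resulting difference. *)
Definition filler (v : node) :=
  let k := logn 2 (stage v) in let m := filler_count v in
  if shifts_average v (z1 k m) then z1 k m else z2 k m.

Definition digits (v : node) := if ready v then [:: filler v] else Z.
Definition step_length (v : node) := if ready v then filler_length v else N.
Definition weight (v : node) z := if ready v then 1 else D N z `^ (- t) / W.
Definition pullback (v : node) z := xget a [set y |
  iter (time v) f y = z /\ tracks d f del (time v) (base v) y].
Definition child (v : node) z : node :=
  Node (time v + step_length v) (pullback v z)
  (stage v + ready v) (mass v * weight v z).

(** The bound on the mass makes [tree_escape] applicable, see
    [children_separated]. *)
Definition admissible (v : node) :=
  [/\ iter (time v) f (base v) = a, 0 < mass v &
    mass v * D (time v) (base v) `^ t <= 1].

Let L1 : 1 < L.
Proof. exact: lt_le_trans lam1 (le_trans (es_w_ge sys a) (es_w_le sys a)). Qed.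
Let L0 : 0 < L. Proof. by move: L1; lra. Qed.
Let rad_gt0 : 0 < rad. Proof. by rewrite /rad divr_gt0. Qed.
Let lamV : 0 < lam^-1 /\ lam^-1 < 1.
Proof. by rewrite invr_gt0 invf_lt1. Qed.
Let rho_rad : 0 < rho /\ rho <= rad.
Proof. by have [? ?] := lamV; move: rad_gt0; rewrite /rho; split; nra. Qed.
Let rad_del : rad <= del. Proof. by move: del0; rewrite /rad; lra. Qed.
Let E0 : 0 < E := distortion_gt0 lam c del.
Let Et0 : 0 < E `^ t. Proof. by rewrite powR_gt0. Qed.
Let Lt1 : 1 < L `^ t. Proof. by rewrite powR_gt1. Qed.
Let W0 : 0 < W.
Proof. by apply: lt_le_trans W_large; rewrite !mulr_gt0//; move: Lt1; lra. Qed.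
Let D0 n x : 0 < D n x := cocycle_gt0 sys n x.
Let Dt0 n x : 0 < D n x `^ t. Proof. by rewrite powR_gt0. Qed.

Lemma filler_shifts_average v : (0 < filler_count v)%N ->
  shifts_average v (filler v).
Proof.
move=> m0; rewrite /filler; set k := logn 2 _; set m := filler_count v.
case: ifPn => //; rewrite /shifts_average -/m -/k; set A := S _ _ _.
have [_ _ _ _] := loops k m.
rewrite -/(filler_length v); set s1 := S _ _ _; set s2 := S _ _ _ => hs.
set T2 := (_ + _)%:R; set avg := A / _.
have T20 : 0 < T2 :> R.
  by rewrite ltr0n /filler_length addn_gt0 muln_gt0 m0 P0 orbT.
rewrite -ltNge => h1.
have hm : m%:R / (2 * T2) = m%:R / T2 / 2 :> R by rewrite invfM mulrA mulrAC.
have h2 : m%:R / T2 <= (A + s1) / T2 - (A + s2) / T2.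
  rewrite -mulrBl ler_pM2r ?invr_gt0//; lra.
rewrite hm in h1 *.
have := ler_norm (avg - (A + s2) / T2).
have := ler_norm (- (avg - (A + s1) / T2)).
rewrite normrN; lra.
Qed.

Lemma digitsP v z : admissible v -> z \in digits v ->
  [/\ d a z <= rho, iter (step_length v) f z = a & (0 < step_length v)%N].
Proof.
move=> [_ _ _]; rewrite /digits /step_length;
  case: ifP => [/and3P[m0 _ _]|_ zZ].
  rewrite inE => /eqP ->; have [h1 h2 h3 h4 _] :=
    loops (logn 2 (stage v)) (filler_count v).
  by rewrite /filler_length muln_gt0 m0 P0 /filler; case: ifP.
by have [] := Z_return zZ.
Qed.

Lemma pullbackP v z : admissible v -> z \in digits v ->
  iter (time v) f (pullback v z) = z /\
  tracks d f del (time v) (base v) (pullback v z).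
Proof.
move=> iv zv; have [az _ _] := digitsP iv zv; have [e _ _] := iv.
apply: (@xgetPex _ a [set y | iter (time v) f y = z /\
  tracks d f del (time v) (base v) y]).
have [|y h1 h2] := shadow_tracks sys (n := time v) (x := base v) (y := z).
  by rewrite e (le_trans az)//; have [_ /le_trans] := rho_rad; apply.
by exists y.
Qed.

(** The weights of the free children are inverse derivatives to the power t,
    divided by W, and W exceeds the distortion by the factor 2 L^t. *)
Lemma free_ratio v z : admissible v -> z \in digits v -> ~~ ready v ->
  mass (child v z) * D (time (child v z)) (base (child v z)) `^ t <=
  mass v * D (time v) (base v) `^ t / (2 * L `^ t).
Proof.
move=> iv zv nr; have [e tr] := pullbackP iv zv.
rewrite /= /weight /step_length (negbTE nr) cocycleD e.
have h := cocycle_distortion sys (tracks_sym sys tr).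
have h' : D (time v) (pullback v z) `^ t <= E `^ t * D (time v) (base v) `^ t.
  rewrite -powRM ?(ltW E0) ?(ltW (D0 _ _))//.
  by rewrite ge0_ler_powR ?nnegrE ?mulr_ge0 ?(ltW t0) ?(ltW E0) ?(ltW (D0 _ _)).
rewrite powRM ?(ltW (D0 _ _))// powRN.
set q := D N z `^ t; have q0 : 0 < q := Dt0 N z.
set u := D _ (pullback _ _) `^ t in h' *.
have -> : mass v * (q^-1 / W) * (u * q) = mass v * u / W.
  by field; rewrite !gt_eqF.
have [_ m0 _] := iv.
have L2 : 0 < 2 * L `^ t by rewrite mulr_gt0// powR_gt0.
rewrite ler_pdivrMr// mulrAC ler_pdivlMr//.
have k1 := ler_wpM2r (ltW L2) h'.
have k2 := ler_wpM2l (ltW (Dt0 (time v) (base v))) W_large.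
have k3 : u * (2 * L `^ t) <= D (time v) (base v) `^ t * W.
  by apply: le_trans k1 (le_trans _ k2); rewrite mulrC [E `^ t * _]mulrC mulrCA.
by have := ler_wpM2l (ltW m0) k3; rewrite !mulrA.
Qed.

Lemma admissible_child v z : admissible v -> z \in digits v ->
  admissible (child v z).
Proof.
move=> iv zv; have [e tr] := pullbackP iv zv; have [az za l0] := digitsP iv zv.
have [_ m0 mD] := iv; split.
- by rewrite /= addnC iterD e za.
- rewrite /= /weight; case: ifP => _; first by rewrite mulr1.
  by rewrite mulr_gt0// divr_gt0// powR_gt0.
have [r|nr] := boolP (ready v); last first.
  apply: le_trans (free_ratio iv zv nr) _; rewrite ler_pdivrMr ?mulr_gt0//;
    last first.
    by rewrite powR_gt0.
  by move: mD Lt1; lra.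
rewrite /= /weight /step_length r cocycleD e mulr1.
have /and3P[_ _] := r; apply: le_trans.
have h := cocycle_distortion sys (tracks_sym sys tr).
rewrite -!mulrA ler_pM2l// -(powR_expr _ _ L0) -!powRM ?(ltW (D0 _ _))
  ?(ltW E0) ?exprn_ge0 ?(ltW L0) ?mulr_ge0 ?exprn_ge0 ?(ltW E0) ?(ltW L0)//.
rewrite ge0_ler_powR ?nnegrE ?mulr_ge0 ?exprn_ge0 ?(ltW t0) ?(ltW E0)
  ?(ltW (D0 _ _)) ?(ltW L0)//.
rewrite mulrA ler_pM ?(ltW (D0 _ _)) ?(cocycle_le sys)// mulrC//.
Qed.

Lemma child_mass_sum v : admissible v ->
  \sum_(z <- digits v) mass (child v z) = mass v.
Proof.
move=> iv; rewrite /= -mulr_sumr /digits /weight; case: ifP => _.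
  by rewrite big_seq1 mulr1.
by rewrite -mulr_suml divff ?gt_eqF// mulr1.
Qed.

Definition cylinder (v : node) x := forall i, (i <= time v)%N ->
  d (iter i f x) (iter i f (base v)) <= rad.

Lemma cylinder_tracks v x : cylinder v x -> tracks d f del (time v) x (base v).
Proof. by move=> h i /h /le_trans; apply. Qed.

Lemma cylinder_base v : cylinder v (base v).
Proof. by move=> i _; rewrite dxx ltW. Qed.

Lemma cylinder_child v z x : admissible v -> z \in digits v ->
  cylinder (child v z) x -> cylinder v x.
Proof.
move=> iv zv hx i hi; have [e tr] := pullbackP iv zv.
have [az _ l0] := digitsP iv zv.
apply: le_trans (d_tri (iter i f (pullback v z)) _ _) _.
have h1 := tracks_contract_le sys tr hi (lexx _).
have [ea _ _] := iv; rewrite ea e in h1.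
have i_n : (i <= time (child v z))%N by rewrite /= (leq_trans hi)// leq_addr.
have h2 := tracks_contract sys (cylinder_tracks hx) i_n.
have h3 := hx _ (leqnn _); rewrite -/(child v z) in h2 h3.
have h4 : lam * d (iter i f x) (iter i f (pullback v z)) <= rad.
  apply: le_trans h3; apply: le_trans h2.
  rewrite ler_wpM2r// -[leLHS]expr1 ler_weXn2l ?ltW//= subn_gt0.
  by rewrite -(addn0 i) -addnS leq_add.
have h5 : d (iter i f x) (iter i f (pullback v z)) <= lam^-1 * rad.
  by rewrite mulrC ler_pdivlMr// mulrC.
rewrite [d (iter i f (pullback v z)) _]d_sym.
apply: le_trans (lerD h5 (le_trans h1 az)) _.
by rewrite /rho mulrBl mul1r addrC subrK.
Qed.

(** Distinct preimages of a under f^N are more than del apart at some time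
    i <= N, so their cylinders are at least del / 3 apart at that time. *)
Definition separation : R := rad / L ^+ N.

(** If sets of two children contain points at distance r, then after [time v]
    steps these points are at least [separation] apart; by bounded distortion
    the derivative along the segment is at least of order 1 / r. *)
Lemma children_separated v z z' x x' : admissible v -> z \in digits v ->
    z' \in digits v -> z != z' ->
    cylinder (child v z) x -> cylinder (child v z') x' ->
  mass v <= (E ^+ 2 / separation) `^ t * d x x' `^ t.
Proof.
move=> iv zv z'v zz' hx hx'.
have separation_gt0 : 0 < separation by rewrite divr_gt0// exprn_gt0.
have nr : ~~ ready v.
  apply/negP => r; move: zv z'v zz'; rewrite /digits r !inE => /eqP-> /eqP->.
  by rewrite eqxx.
have [e tr] := pullbackP iv zv; have [e' tr'] := pullbackP iv z'v.
have [az za _] := digitsP iv zv; have [az' z'a _] := digitsP iv z'v.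
rewrite /step_length (negbTE nr) in za z'a.
have [i iN hi] : exists2 i, (i <= N)%N & del < d (iter i f z) (iter i f z').
  apply: contrapT => hno; move: zz' => /eqP; apply.
  apply: (tracks_eq sys (n := N)); last by rewrite za z'a.
  by move=> i iN; rewrite leNgt; apply/negP => h; apply: hno; exists i.
have cz := hx (time v + i)%N; have cz' := hx' (time v + i)%N.
rewrite /= /step_length (negbTE nr) leq_add2l addnC !iterD e in cz.
rewrite /= /step_length (negbTE nr) leq_add2l addnC !iterD e' in cz'.
set fx := iter (time v) f x in cz; set fx' := iter (time v) f x' in cz'.
have sep : separation <= d fx fx'.
  rewrite /separation ler_pdivrMr ?exprn_gt0// mulrC.
  apply: (@le_trans _ _ (L ^+ i * d fx fx')); last first.
    by rewrite ler_wpM2r// ler_weXn2l// ltW.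
  apply: le_trans (iter_lipschitz sys i fx fx').
  have := d_tri (iter i f fx) (iter i f z) (iter i f z').
  have := d_tri (iter i f fx') (iter i f fx) (iter i f z').
  move: (cz iN) (cz' iN) hi; rewrite d_sym /rad; lra.
have cx := cylinder_child iv zv hx; have cx' := cylinder_child iv z'v hx'.
have trx : tracks d f del (time v) x x'.
  move=> j hj; apply: le_trans (d_tri (iter j f (base v)) _ _) _.
  have := cx j hj; have := cx' j hj; rewrite [d _ (iter j f (base v))]d_sym.
  by move: del0; rewrite /rad; lra.
have h1 := dist_iter_le sys trx.
have h2 := cocycle_distortion sys (cylinder_tracks cx).
have [_ m0 mD] := iv.
have b0 := D0 (time v) (base v).
have h3 : separation <= E ^+ 2 * D (time v) (base v) * d x x'.
  apply: le_trans sep (le_trans h1 _); rewrite expr2 -!mulrA ler_pM2l//.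
  by rewrite mulrA ler_wpM2r.
have h4 : (D (time v) (base v))^-1 <= E ^+ 2 / separation * d x x'.
  rewrite -div1r ler_pdivrMr// -[E ^+ 2 / separation * _ * _]mulrA mulrAC.
  by rewrite ler_pdivlMr// mul1r [d x x' * _]mulrC mulrA.
have E2 : 0 <= E ^+ 2 / separation by rewrite divr_ge0 ?exprn_ge0 ?(ltW E0)
  ?(ltW separation_gt0).
have h5 : (D (time v) (base v))^-1 `^ t <= (E ^+ 2 / separation * d x x') `^ t.
  have n1 : (D (time v) (base v))^-1 \in Num.nneg by rewrite nnegrE invr_ge0
    ltW.
  have n2 : E ^+ 2 / separation * d x x' \in Num.nneg by rewrite nnegrE
    mulr_ge0.
  exact: (ge0_ler_powR (ltW t0) n1 n2 h4).
rewrite -powRM//; apply: le_trans h5.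
rewrite -[X in X `^ t]powR_inv1 ?(ltW b0)// -powRrM mulN1r powRN -div1r.
by rewrite ler_pdivlMr.
Qed.
Section Path.
Variable path : nat -> node.
Hypothesis path0 : path 0 = Node 0 a 0 1.
Hypothesis path_inv : forall n, admissible (path n).
Hypothesis path_step : forall n,
  exists2 z, z \in digits (path n) & path n.+1 = child (path n) z.

Lemma path_time n : (n <= time (path n))%N.
Proof.
elim: n => // n IH; have [z zv ->] := path_step n.
have [_ _ l0] := digitsP (path_inv n) zv.
by rewrite /= -addn1 leq_add.
Qed.

Lemma path_cylinder n k x : cylinder (path (n + k)) x -> cylinder (path n) x.
Proof.
elim: k => [|k IH]; first by rewrite addn0.
rewrite addnS; have [z zv ->] := path_step (n + k).
by move=> /(cylinder_child (path_inv _) zv)/IH.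
Qed.

(** In i consecutive free steps the bound on the mass gains the factor
    (2 L^t)^i, whereas a filler of length at most [time v0 + i] costs
    (L^t)^(time v0 + i). *)
Lemma path_ready n : exists i, ready (path (n + i)).
Proof.
apply: contrapT => hno.
have nr i : ~~ ready (path (n + i)) by apply/negP => h; apply: hno; exists i.
set v0 := path n; set q := (2 * L `^ t)^-1.
have L2 : 0 < 2 * L `^ t by rewrite mulr_gt0// powR_gt0.
have free i : [/\ time (path (n + i)) = (time v0 + i * N)%N,
    stage (path (n + i)) = stage v0 &
    mass (path (n + i)) * D (time (path (n + i))) (base (path (n + i))) `^ t
      <= q ^+ i].
  elim: i => [|i [h1 h2 h3]].
    rewrite addn0 mul0n addn0 expr0; split=> //.
    by have [_ _] := path_inv n.
  rewrite addnS; have [z zv ->] := path_step (n + i).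
  have := free_ratio (path_inv _) zv (nr i).
  rewrite /= /step_length (negbTE (nr i)) h1 h2 addn0 -addnA -mulSnr => h4;
    split=> //.
  apply: le_trans h4 _; rewrite exprSr; rewrite ler_wpM2r ?invr_ge0 ?(ltW L2)//.
  by rewrite -h1.
set k := logn 2 (stage v0).
have [n1 hn1] := expr_large (E `^ t * (L `^ t) ^+ time v0) (ltr1n R 2).
set i := maxn n1 (maxn (N * P k) (stage v0)).
have i1 : (n1 <= i)%N by rewrite leq_maxl.
have i2 : (N * P k <= i)%N by rewrite (leq_trans (leq_maxl _ _) (leq_maxr _ _)).
have i3 : (stage v0 <= i)%N by rewrite (leq_trans (leq_maxr _ _) (leq_maxr _
  _)).
have iT : (i <= time v0 + i * N)%N.
  by apply: leq_trans (leq_addl _ _); rewrite leq_pmulr.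
have [h1 h2 h3] := free i.
move/negP: (nr i); apply; apply/and3P; split.
- by rewrite /filler_count h1 h2 divn_gt0 ?muln_gt0 ?N0 ?P0// (leq_trans i2).
- by rewrite h1 h2 (leq_trans i3).
have hl : (filler_length (path (n + i)) <= time v0 + i)%N.
  rewrite -(leq_pmul2r N0) mulnDl.
  apply: (@leq_trans (time v0 + i * N)%N); last by rewrite leq_add2r leq_pmulr.
  rewrite /filler_length /filler_count h1 h2 -/k -mulnA [(P k * N)%N]mulnC.
  exact: leq_trunc_div.
have Lt1' := ltW Lt1.
apply: (@le_trans _ _ (q ^+ i * E `^ t * (L `^ t) ^+ (time v0 + i))).
  apply: ler_pM; rewrite ?exprn_ge0 ?powR_ge0//.
  - rewrite mulr_ge0 ?powR_ge0// mulr_ge0 ?powR_ge0//.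
    by have [_ /ltW] := path_inv (n + i).
  - by rewrite ler_wpM2r ?powR_ge0.
  - exact: ler_weXn2l.
have Li : 0 < (L `^ t) ^+ i by rewrite exprn_gt0// powR_gt0.
rewrite exprD /q exprVn exprMn invfM.
have -> : (2 ^+ i)^-1 / (L `^ t) ^+ i * E `^ t *
    ((L `^ t) ^+ time v0 * (L `^ t) ^+ i) =
    E `^ t * (L `^ t) ^+ time v0 / 2 ^+ i.
  have n2 : (2 : R) ^+ i != 0 by rewrite expf_neq0.
  by field; rewrite n2 gt_eqF.
by rewrite ler_pdivrMr ?exprn_gt0// mul1r hn1.
Qed.

Lemma path_stage j : exists2 n, ready (path n) & stage (path n) = j.
Proof.
have next n : exists2 m, ready (path m) & stage (path m) = stage (path n).
  have [i ri hmin] := ex_minnP (path_ready n).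
  exists (n + i)%N => //; have {ri} : forall l, (l <= i)%N ->
      stage (path (n + l)) = stage (path n); last exact.
  elim=> [|l IH li]; first by rewrite addn0.
  rewrite addnS; have [z _ ->] := path_step (n + l).
  rewrite /= IH ?(ltnW li)//.
  case: (boolP (ready _)) => [/hmin|_]; last by rewrite addn0.
  by rewrite leqNgt li.
elim: j => [|j [n rn sn]].
  by have [m rm sm] := next 0%N; exists m; rewrite // sm path0.
have [m rm sm] := next n.+1; exists m => //; rewrite sm.
by have [z _ ->] := path_step n; rewrite /= rn sn addn1.
Qed.

Lemma path_mass n : mass (path n) <= ((lam `^ t) ^+ n)^-1.
Proof.
have [_ m0 mD] := path_inv n.
rewrite -div1r ler_pdivlMr ?exprn_gt0 ?powR_gt0//.
apply: le_trans mD; rewrite ler_pM2l// -powR_expr//.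
have h : lam ^+ n <= D (time (path n)) (base (path n)).
  apply: le_trans (cocycle_ge sys _ _).
  by rewrite ler_weXn2l ?path_time// ltW.
by rewrite ge0_ler_powR ?nnegrE ?exprn_ge0 ?(ltW t0) ?(ltW lam_gt0) ?(ltW (D0
  _ _)).
Qed.

(** The base points form a Cauchy sequence, and each of them lies in the
    cylinders of all earlier nodes. *)
Lemma path_limit : exists x, forall n, cylinder (path n) x.
Proof.
pose e n := (lam ^+ n)^-1 * rad.
have e_ge0 n : 0 <= e n by rewrite mulr_ge0 ?invr_ge0 ?exprn_ge0 ?(ltW
  lam_gt0) ?(ltW rad_gt0).
have e_small r : 0 < r -> exists n0, forall n, (n0 <= n)%N -> e n <= r.
  move=> r0; have [n0 hn0] := expr_large (rad / r) lam1.
  exists n0 => n /hn0; rewrite ler_pdivrMr// => h.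
  by rewrite /e mulrC ler_pdivrMr ?exprn_gt0// mulrC.
have base_in m n : (m <= n)%N -> cylinder (path m) (base (path n)).
  move=> mn; apply: (@path_cylinder m (n - m)); rewrite subnKC//.
  exact: cylinder_base.
have [|m n mn|x hx] := es_complete sys (u := fun n => base (path n)) (e := e).
- move=> r r0; have r2 : 0 < r / 2 by rewrite divr_gt0.
  have [n hn] := e_small _ r2; exists n; apply: le_lt_trans (hn _ (leqnn n)) _.
  by rewrite gtr_pMr// invf_lt1// ltr1n.
- have hc := base_in _ _ mn.
  have := tracks_contract sys (cylinder_tracks hc) (leq0n _).
  rewrite subn0 /= => h; rewrite /e mulrC ler_pdivlMr ?exprn_gt0// mulrC.
  apply: le_trans (le_trans h (hc _ (leqnn _))).
  by rewrite ler_wpM2r// ler_weXn2l ?path_time// ltW.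
exists x => n i hi; apply/ler_addgt0Pr => r r0.
have rL : 0 < r / L ^+ i by rewrite divr_gt0// exprn_gt0.
have [m0 hm0] := e_small _ rL.
set m := maxn m0 n.
apply: le_trans (d_tri (iter i f (base (path m))) _ _) _.
rewrite addrC lerD//; first by apply: base_in => //; apply: leq_maxr.
apply: le_trans (iter_lipschitz sys i _ _) _.
rewrite mulrC -ler_pdivlMr ?exprn_gt0//.
exact: le_trans (hx m) (hm0 _ (leq_maxl _ _)).
Qed.

(** At a node that gets a filler for phi k, the sums at x and at the base points
    agree up to a constant, both before and after the filler; the averages at
    these two times differ by an amount that does not depend on the node. *)
Lemma path_irregular x k : (forall n, cylinder (path n) x) ->
  not_cauchy (fun T => S (phi k) T x / T%:R).
Proof.
move=> hx; set C := (N * P k)%:R : R.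
have NP0 : (0 < N * P k)%N by rewrite muln_gt0 N0 P0.
have C0 : 0 < C by rewrite ltr0n.
exists (16 * C)^-1; first by rewrite invr_gt0 mulr_gt0.
move=> n0; have [al0 H0 _] := phi_holder k.
set K := holder_sum lam (al k) (H k) * del `^ al k.
have hK n y y' : tracks d f del n y y' ->
    `|S (phi k) n y - S (phi k) n y'| <= K.
  move=> tr; apply: le_trans (birkhoff_tracks sys (phi_holder k) tr) _.
  rewrite ler_wpM2l ?(holder_sum_ge0 sys)//.
  by rewrite ge0_ler_powR ?nnegrE ?(ltW al0) ?(ltW del0)//; apply: tr.
(* The stage j has 2-adic valuation k; 48 is the factor in [average_gap]. *)
set q := maxn n0 (Num.truncn (48 * K * C)).+1.
pose j := (2 ^ k * (q.*2.+1))%N.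
have qj : (q <= j)%N.
  rewrite (@leq_trans q.*2.+1)// ?leq_pmull ?expn_gt0//.
  by rewrite -addnn leqW// leq_addr.
have jk : logn 2 j = k.
  rewrite lognM ?expn_gt0// pfactorK// logn_coprime ?addn0//.
  by rewrite coprime2n /= odd_double.
have [n rn sn] := path_stage j.
have [z zv ez] := path_step n.
have iv := path_inv n.
have [m0 jT _] := and3P rn.
set v := path n in rn sn zv ez iv m0 jT *.
set T1 := time v in jT *; set l := filler_length v.
have zE : z = filler v by move: zv; rewrite /digits rn inE => /eqP.
have time2 : time (path n.+1) = (T1 + l)%N by rewrite ez /= /step_length rn.
have mv := filler_shifts_average m0.
rewrite /shifts_average -zE sn jk -/T1 -/l in mv.
have [e tr] := pullbackP iv zv; rewrite -/T1 in e tr.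
have lP : l = (filler_count v * P k)%N by rewrite /l /filler_length sn jk.
have lT : (l <= T1)%N.
  rewrite lP; apply: leq_trans (leq_trunc_div T1 (N * P k)).
  by rewrite /filler_count sn jk leq_mul2l leq_pmull// orbT.
have qT : (q <= T1)%N by rewrite (leq_trans qj)// -sn.
have n0T : (n0 <= T1)%N by rewrite (leq_trans (leq_maxl _ _) qT).
have T1_gt0 : (0 < T1)%N.
  by rewrite (leq_trans _ qT)// (leq_trans _ (leq_maxr _ _)).
exists T1, (T1 + l)%N; split=> //; first by rewrite (leq_trans n0T)// leq_addr.
have hx1 := hx n; have hx2 := hx n.+1.
apply: (average_gap (K := K) mv); rewrite ?ltr0n//.
- by apply: hK; apply: cylinder_tracks.
- have := hK _ _ _ (cylinder_tracks hx2); rewrite time2 ez /=.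
  rewrite (birkhoffD f (phi k) T1 l (pullback v z)) e.
  have := hK _ _ _ (tracks_sym sys tr).
  rewrite -/T1 -/v; set b1 := S _ T1 (pullback v z); set b2 := S _ T1 (base v).
  set b3 := S _ l z; set b4 := S _ _ x => h1 h2.
  have -> : b4 - (b2 + b3) = (b4 - (b1 + b3)) + (b1 - b2).
    by rewrite !opprD !addrA; ring.
  by apply: le_trans (ler_normD _ _) _; rewrite mulr2n mulrDl !mul1r lerD.
- by rewrite ler_nat leq_addr.
- by rewrite -natrM ler_nat mul2n -addnn leq_add2l.
- have := ltn_ceil T1 NP0; rewrite -jk -sn -/(filler_count v) => /ltnW h.
  rewrite -natrM -natrM ler_nat; apply: leq_trans h _.
  rewrite sn jk mulnAC leq_mul2r; apply/orP; right.
  by rewrite mul2n -addnn -addn1 leq_add2l.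
- apply: ltW; apply: lt_le_trans (truncnS_gt _) _.
  by rewrite ler_nat (leq_trans (leq_maxr _ _) qT).
Qed.

End Path.

Variables (V : nat -> set X) (r : nat -> R).
Hypothesis r0 : forall j, 0 < r j.
Hypothesis V_diam : forall j x y, V j x -> V j y -> d x y <= r j.
Hypothesis r_sum : forall n,
  \sum_(j < n) r j `^ t <= (2 * (E ^+ 2 / separation) `^ t)^-1.

Lemma irregular_point_outside : exists2 x, forall j, ~ V j x &
  forall k, not_cauchy (fun T => S (phi k) T x / T%:R).
Proof.
have separation_gt0 : 0 < separation by rewrite divr_gt0// exprn_gt0.
set G := (E ^+ 2 / separation) `^ t.
have G0 : 0 < G by rewrite powR_gt0// divr_gt0// exprn_gt0.
pose meets j v := exists2 x, V j x & cylinder v x.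
have admissible_root : admissible (Node 0 a 0 1).
  by split=> //; rewrite /= cocycle0 powR1 mulr1.
have sum_a n : \sum_(j < n) (G * r j `^ t) <= 2^-1 * mass (Node 0 a 0 1).
  rewrite -mulr_sumr mulr1; apply: le_trans (ler_wpM2l (ltW G0) (r_sum n)) _.
  by rewrite invfM mulrCA mulfV ?gt_eqF// mulr1.
have [| | | | | |path [path0 path_inv path_step path_escape]] :=
  tree_escape (child := child) (digits := digits) (meets := meets)
    (a := fun j => G * r j `^ t) (s := 2^-1)
    admissible_root admissible_child _ _ child_mass_sum _ _ _ _ sum_a.
- by move=> v [].
- by move=> v _; rewrite /digits; case: ifP.
- by move=> j v z iv zv [x Vx cx]; exists x => //; apply: cylinder_child cx.
- move=> j v z z' iv zv z'v zz' [x Vx cx] [x' Vx' cx'].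
  apply: le_trans (children_separated iv zv z'v zz' cx cx') _.
  rewrite ler_wpM2l ?powR_ge0//.
  by rewrite ge0_ler_powR ?nnegrE ?(ltW t0) ?(ltW (r0 j))//;
    apply: V_diam Vx Vx'.
- by move=> j; rewrite mulr_gt0// powR_gt0.
- by rewrite invf_lt1// ltr1n.
have [x hx] := path_limit path_inv path_step.
exists x => [j Vx|k]; last exact: path_irregular path0 path_inv path_step _ _
  hx.
have lt1 : 1 < lam `^ t by rewrite powR_gt1.
have a0 : 0 < G * r j `^ t by rewrite mulr_gt0// powR_gt0.
have [n hn] := expr_large (G * r j `^ t)^-1 lt1.
have : G * r j `^ t < mass (path n) by apply: path_escape; exists x.
apply/negP; rewrite -leNgt; apply: le_trans (path_mass path_inv path_step n) _.
by rewrite -[leRHS]invrK lef_pV2 ?posrE ?invr_gt0 ?exprn_gt0 ?hn// powR_gt0.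
Qed.

End Irregular.

Section Escape.
Variables (R : realType) (X : choiceType) (d : X -> X -> R) (f : X -> X).
Variables (w : X -> R) (lam L c del : R).
Hypothesis sys : expanding_system d f w lam L c del.

Local Notation S := (birkhoff f).
Local Notation E := (distortion lam c del).

Let lam1 : 1 < lam := es_lam sys.
Let del0 : 0 < del := es_del sys.
Let lam_gt0 : 0 < lam. Proof. by move: lam1; lra. Qed.

Theorem irregular_set_escapes (a : X) t t' h0 eps (phi : nat -> X -> R) :
    0 < t -> t < t' -> 0 < h0 -> 0 < eps -> cover_bound d t' h0 eps ->
    (forall k, exists al H, holder d (phi k) al H) ->
    (forall k, ~ cohomologous_const d f del (phi k)) ->
  exists2 kappa, 0 < kappa & forall (V : nat -> set X) (r : nat -> R),
    (forall j, 0 < r j) -> (forall j x y, V j x -> V j y -> d x y <= r j) ->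
    (forall n, \sum_(j < n) r j `^ t <= kappa) ->
  exists2 x, forall j, ~ V j x &
  forall k, not_cauchy (fun T => S (phi k) T x / T%:R).
Proof.
move=> t0 tt' h00 eps0 hcov hphi ncoh.
have [al hal] := choice hphi; have [H hH] := choice hal.
set rho := (1 - lam^-1) * (del / 3).
have lamV : lam^-1 < 1 by rewrite invf_lt1.
have lamV0 : 0 < lam^-1 by rewrite invr_gt0.
have rho0 : 0 < rho by rewrite mulr_gt0 ?subr_gt0// divr_gt0.
have rho_del : rho <= del by rewrite /rho; move: del0 => del0'; nra.
have loops k := returning_loops sys a rho0 rho_del (hH k) (ncoh k).
have [P hP] : exists P, forall k, (0 < P k)%N /\ forall m, exists z1 z2,
    [/\ d a z1 <= rho, d a z2 <= rho, iter (m * P k) f z1 = a,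
        iter (m * P k) f z2 = a &
        m%:R <= S (phi k) (m * P k) z1 - S (phi k) (m * P k) z2].
  have h k : exists Pk, (0 < Pk)%N /\ forall m, exists z1 z2,
    [/\ d a z1 <= rho, d a z2 <= rho, iter (m * Pk) f z1 = a,
        iter (m * Pk) f z2 = a &
        m%:R <= S (phi k) (m * Pk) z1 - S (phi k) (m * Pk) z2].
    by have [Pk h1 h2] := loops k; exists Pk.
  by have [P hP] := choice h; exists P.
have ch T (Q : nat -> nat -> T -> Prop) :
    (forall k m, exists z, Q k m z) -> exists z, forall k m, Q k m (z k m).
  move=> h; have h' k : exists z, forall m, Q k m (z m).
    by have [z hz] := choice (h k); exists z.
  by have [z hz] := choice h'; exists z.
have [z1 hz1] := ch _ _ (fun k => (hP k).2).
have [z2 hz2] := ch _ _ hz1.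
have [N [Z [N0 uZ hZ hW]]] := many_returns sys a (2 * L `^ t * E `^ t)
  rho0 t0 tt' h00 eps0 hcov.
have L0 : 0 < L.
  by apply: lt_le_trans lam_gt0 (le_trans (es_w_ge sys a) (es_w_le sys a)).
have E0 : 0 < E := distortion_gt0 lam c del.
exists (2 * (E ^+ 2 / separation L del N) `^ t)^-1.
  by rewrite invr_gt0 mulr_gt0// powR_gt0// divr_gt0 ?divr_gt0 ?exprn_gt0.
move=> V r r0 Vr hr.
exact: (irregular_point_outside sys t0 N0 uZ hZ hW hH (fun k => (hP k).1) hz2
  r0 Vr hr).
Qed.

End Escape.

(** * Complex modulus and polynomials *)

Section Modulus.
Variable R : realType.
Implicit Types x y z : R[i].

Lemma normrC z : `|z| = (cabs z)%:C. Proof. by []. Qed.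

Lemma cabs_ge0 z : 0 <= cabs z.
Proof. by rewrite -lecR -normrC normr_ge0. Qed.

Lemma cabs0 : cabs (0 : R[i]) = 0.
Proof. exact: ComplexField.Normc.normc0. Qed.

Lemma cabs1 : cabs (1 : R[i]) = 1.
Proof. exact: ComplexField.Normc.normc1. Qed.

Lemma cabs_eq0 z : cabs z = 0 -> z = 0.
Proof. exact: ComplexField.Normc.eq0_normc. Qed.

Lemma cabsM x y : cabs (x * y) = cabs x * cabs y.
Proof. exact: ComplexField.Normc.normcM. Qed.

Lemma cabsV x : cabs x^-1 = (cabs x)^-1.
Proof. exact: ComplexField.Normc.normcV. Qed.

Lemma cabsN x : cabs (- x) = cabs x.
Proof. exact: normcN. Qed.

Lemma cabsB x y : cabs (x - y) = cabs (y - x).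
Proof. by rewrite -cabsN opprB. Qed.

Lemma cabsD x y : cabs (x + y) <= cabs x + cabs y.
Proof. by rewrite -lecR rmorphD -!normrC ler_normD. Qed.

Lemma cabs_triangle y x z : cabs (x - z) <= cabs (x - y) + cabs (y - z).
Proof. by rewrite -[x - z](subrKA y) cabsD. Qed.

Lemma cabsX x n : cabs (x ^+ n) = cabs x ^+ n.
Proof. by elim: n => [|n IH]; rewrite ?expr0 ?cabs1// !exprS cabsM IH. Qed.

Lemma cabs_real (r : R) : 0 <= r -> cabs r%:C = r.
Proof. by move=> r0; rewrite /cabs /= expr0n addr0 sqrtr_sqr ger0_norm. Qed.

Lemma cabs_nat n : cabs (n%:R : R[i]) = n%:R.
Proof. by rewrite -(rmorph_nat (real_complex R)) cabs_real. Qed.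

Lemma cabs_gt0 z : z != 0 -> 0 < cabs z.
Proof.
by move=> /eqP z0; rewrite lt_def cabs_ge0 andbT; apply/eqP => /cabs_eq0.
Qed.

Lemma cabs_prod (s : seq R[i]) (F : R[i] -> R[i]) :
  cabs (\prod_(i <- s) F i) = \prod_(i <- s) cabs (F i).
Proof. exact: (big_morph (@cabs R) cabsM cabs1). Qed.

Lemma Re_le_cabs z : `|complex.Re z| <= cabs z.
Proof.
case: z => u v; rewrite /cabs /= -sqrtr_sqr ler_wsqrtr//.
by rewrite lerDl sqr_ge0.
Qed.

Lemma Im_le_cabs z : `|complex.Im z| <= cabs z.
Proof.
case: z => u v; rewrite /cabs /= -sqrtr_sqr ler_wsqrtr//.
by rewrite lerDr sqr_ge0.
Qed.

Lemma cabs_le_ReIm z : cabs z <= `|complex.Re z| + `|complex.Im z|.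
Proof.
rewrite {1}[z]complexE; apply: le_trans (cabsD _ _) _.
rewrite cabsM; have -> : cabs 'i = 1 :> R.
  by rewrite /cabs /= expr0n expr1n add0r sqrtr1.
by rewrite mul1r /cabs /= !expr0n !addr0 !sqrtr_sqr.
Qed.

Lemma exists_root_of_m1 n : (0 < n)%N ->
  exists2 om : R[i], om ^+ n = -1 & cabs om = 1.
Proof.
move=> n0; have /closed_rootP[om] : size ('X^n + 1%:P : {poly R[i]}) != 1%N.
  by rewrite size_XnaddC// eqSS -lt0n.
rewrite /root hornerD hornerXn hornerC addr_eq0 => /eqP e; exists om => //.
apply/eqP; rewrite -(pexpr_eq1 n0) ?cabs_ge0// -cabsX e cabsN cabs1//.
Qed.
End Modulus.

Section Polynomials.
Variable R : realType.
Local Notation C := R[i].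
Implicit Types p q : {poly C}.

Lemma poly_bounded p M : 0 <= M ->
  exists2 B, 0 <= B & forall x : C, cabs x <= M -> cabs p.[x] <= B.
Proof.
move=> M0; elim/poly_ind: p => [|p c [B B0 hB]].
  by exists 0 => // x _; rewrite horner0 cabs0.
exists (B * M + cabs c); first by rewrite addr_ge0 ?cabs_ge0 ?mulr_ge0.
move=> x xM; rewrite hornerMXaddC; apply: le_trans (cabsD _ _) _.
by rewrite cabsM lerD2r ler_pM ?cabs_ge0 ?hB.
Qed.

Lemma poly_taylor p M : 0 <= M ->
  exists2 B, 0 <= B & forall x y : C, cabs x <= M -> cabs y <= M ->
    cabs (p.[y] - p.[x] - p^`().[x] * (y - x)) <= B * cabs (y - x) ^+ 2.
Proof.
move=> M0; elim/poly_ind: p => [|p c [B B0 hB]].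
  exists 0 => // x y _ _; rewrite deriv0 !horner0 subrr mul0r subr0 mul0r.
  by rewrite cabs0.
have [B' B'0 hB'] := poly_bounded p^`() M0.
exists (B * M + B'); first by rewrite addr_ge0 ?mulr_ge0.
move=> x y xM yM; rewrite derivMXaddC !hornerMXaddC hornerD hornerMX.
have -> : p.[y] * y + c - (p.[x] * x + c) - (p.[x] + p^`().[x] * x) * (y - x) =
   (p.[y] - p.[x] - p^`().[x] * (y - x)) * y + p^`().[x] * (y - x) ^+ 2 by ring.
apply: le_trans (cabsD _ _) _.
rewrite [leRHS]mulrDl; apply: lerD.
  by rewrite cabsM mulrAC; apply: ler_pM; rewrite ?cabs_ge0 ?hB.
by rewrite cabsM -cabsX ler_wpM2r ?cabs_ge0 ?hB'.
Qed.

Lemma poly_lipschitz p M : 0 <= M ->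
  exists2 B, 0 <= B & forall x y : C, cabs x <= M -> cabs y <= M ->
    cabs (p.[y] - p.[x]) <= B * cabs (y - x).
Proof.
move=> M0; have [B B0 hB] := poly_taylor p M0.
have [B' B'0 hB'] := poly_bounded p^`() M0.
exists (B * (2 * M) + B'); first by rewrite addr_ge0 ?mulr_ge0.
move=> x y xM yM; rewrite -[_ - _](subrK (p^`().[x] * (y - x))).
apply: le_trans (cabsD _ _) _; rewrite mulrDl lerD//; last first.
  by rewrite cabsM ler_wpM2r ?cabs_ge0 ?hB'.
apply: le_trans (hB _ _ xM yM) _; rewrite expr2 -mulrA ler_wpM2l//.
rewrite ler_wpM2r ?cabs_ge0//; apply: le_trans (cabsD _ _) _.
by rewrite cabsN mulr2n mulrDl mul1r lerD.
Qed.

(** The modulus of p(w) - y is the product of the distances from w to the roots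
    of p - y, times that of the leading coefficient; hence one of the roots is
    close.  This replaces the open mapping theorem. *)
Lemma root_near p (w y : C) del : (1 < size p)%N -> 0 < del ->
    cabs (p.[w] - y) <= cabs (lead_coef p) * del ^+ (size p).-1 ->
  exists2 z, p.[z] = y & cabs (w - z) <= del.
Proof.
move=> sp del0 h.
have szy : size (p - y%:P) = size p.
  by rewrite size_polyDl// size_polyN size_polyC; case: eqP => // _;
    apply: leq_trans sp.
have lcy : lead_coef (p - y%:P) = lead_coef p.
  rewrite lead_coefDl// size_polyN size_polyC.
  by case: eqP => // _; apply: leq_trans sp.
have [r er] := closed_field_poly_normal (p - y%:P).
rewrite lcy in er.
have lc0 : lead_coef p != 0 by rewrite lead_coef_eq0 -size_poly_gt0 (ltn_trans
  _ sp).
have szr : size r = (size p).-1.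
  by rewrite -szy er size_scale// size_prod_XsubC.
have rootE z : z \in r -> p.[z] = y.
  move=> zr; apply/eqP; rewrite -subr_eq0 -[y in _ - y](hornerC y z) -hornerN
    -hornerD.
  by rewrite er hornerZ mulf_eq0; apply/orP; right;
    rewrite -/(root _ _) root_prod_XsubC.
apply: contrapT => hno.
have far z : z \in r -> del < cabs (w - z).
  move=> zr; rewrite ltNge; apply/negP => hz; apply: hno; exists z => //.
  exact: rootE.
have : cabs (p.[w] - y) = cabs (lead_coef p) * \prod_(z <- r) cabs (w - z).
  rewrite -[y in LHS](hornerC y w) -hornerN -hornerD er hornerZ cabsM
    horner_prod.
  by rewrite cabs_prod; congr (_ * _); apply: eq_bigr => z _;
    rewrite hornerXsubC.
move=> e; move: h; rewrite e ler_pM2l ?cabs_gt0// -szr.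
apply/negP; rewrite -ltNge.
have : (0 < size r)%N by rewrite szr -ltnS prednK// ltnW.
move: far; case: (r) => // z0 s far _.
rewrite big_cons /= exprS.
have h0 : del < cabs (w - z0) by apply: far; rewrite inE eqxx.
have h1 : del ^+ size s <= \prod_(j <- s) cabs (w - j).
  have {}far z : z \in s -> del < cabs (w - z) by move=> zs; apply: far;
    rewrite inE zs orbT.
  elim: s far => [|z s IH] far; first by rewrite big_nil.
  rewrite big_cons exprS ler_pM ?exprn_ge0 ?(ltW del0)//.
    by rewrite ltW// far// inE eqxx.
  by apply: IH => x xs; apply: far; rewrite inE xs orbT.
apply: (@lt_le_trans _ _ (cabs (w - z0) * del ^+ size s)).
  by rewrite ltr_pM2r// exprn_gt0.
by rewrite ler_wpM2l// cabs_ge0.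
Qed.

End Polynomials.

(** * Cauchy's estimate for the inverse of a polynomial *)

Section CauchyEstimate.
Variable R : realType.
Local Notation C := R[i].

(** If om^(2^K) = -1, replacing q(z) by (q(z) + q(om z) / om) / 2 keeps both the
    linear coefficient and the bound on the disc, and kills the coefficients
    of z^(i+1) for i an odd multiple of 2^K, as well as the constant one
    when K = 0. *)
Lemma thin_coefficients (c : nat -> C) n rho M K :
    (forall z : C, cabs z <= rho -> cabs (\sum_(i < n) c i * z ^+ i) <= M) ->
  exists c' : nat -> C, [/\ c' 1%N = c 1%N,
    forall z : C, cabs z <= rho -> cabs (\sum_(i < n) c' i * z ^+ i) <= M,
    (0 < K)%N -> c' 0%N = 0 &
    forall i, ~~ (2 ^ K %| i)%N -> c' i.+1 = 0].
Proof.
move=> h; elim: K => [|K [c' [c'1 hc' c'0 hK]]].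
  by exists c; split=> // i; rewrite expn0 dvd1n.
have [om omK om1] := @exists_root_of_m1 R (2 ^ K) (expn_gt0 2 K).
have om0 : om != 0 by apply/eqP => e; move: om1; rewrite e cabs0 => /eqP;
  rewrite eq_sym oner_eq0.
have two0 : (2 : C) != 0 by rewrite pnatr_eq0.
pose b i := c' i * (1 + om ^+ i / om) / 2.
have bS i : b i.+1 = c' i.+1 * (1 + om ^+ i) / 2 by rewrite /b exprSr mulfK.
exists b; split.
- by rewrite bS expr0 c'1 -[1 + 1]/(2 : C) mulfK.
- move=> z zr.
  have -> : \sum_(i < n) b i * z ^+ i =
      (\sum_(i < n) c' i * z ^+ i + om^-1 * \sum_(i < n) c' i * (om * z) ^+ i)
        / 2.
    rewrite mulr_sumr -big_split mulr_suml; apply: eq_bigr => i _ /=.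
    by rewrite /b exprMn; field; rewrite om0.
  rewrite cabsM cabsV cabs_nat ler_pdivrMr// mulr_natr mulr2n.
  apply: le_trans (cabsD _ _) _; apply: lerD; first exact: hc'.
  by rewrite cabsM cabsV om1 invr1 mul1r hc'// cabsM om1 mul1r.
- move=> _; case: (posnP K) => [K0|K0]; last by rewrite /b c'0// !mul0r.
  have omE : om = -1 by move: omK; rewrite K0 expn0 expr1.
  by rewrite /b expr0 omE mul1r invrN1 subrr mulr0 mul0r.
move=> i hi; rewrite bS; have [/dvdnP[m e]|ni] := boolP (2 ^ K %| i)%N;
  last first.
  by rewrite hK// !mul0r.
have om_i : om ^+ i = -1.
  rewrite e mulnC exprM omK -signr_odd.
  suff -> : odd m by rewrite expr1.
  by move: hi; rewrite e expnS dvdn_pmul2r ?expn_gt0// dvdn2 negbK.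
by rewrite om_i subrr mulr0 mul0r.
Qed.

(** After [thin_coefficients] the linear term only is left. *)
Lemma coef1_le (q : {poly C}) rho M : 0 <= rho ->
    (forall z, cabs z <= rho -> cabs q.[z] <= M) -> cabs q`_1 * rho <= M.
Proof.
move=> rho0 hq; set n := (size q).+2.
have hsum z : cabs z <= rho -> cabs (\sum_(i < n) q`_i * z ^+ i) <= M.
  by move=> zr; rewrite -horner_coef_wide ?hq//; apply: leqW; apply: leqnSn.
have [c [c1 hc c0 hK]] := thin_coefficients n hsum.
have nK : (n < 2 ^ n)%N by apply: ltn_expl.
have := hc rho%:C; rewrite cabs_real// lexx => /(_ isT).
rewrite big_ord_recl big_ord_recl big1 ?c0// => [|i _].
  by rewrite mul0r add0r addr0 expr1 cabsM c1 cabs_real.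
have ni : ~~ (2 ^ n %| i.+1)%N.
  rewrite gtnNdvd// (leq_ltn_trans _ nK)// ltnW// ltnS ltnW//.
  by rewrite ltnS.
by rewrite (hK i.+1 ni) mul0r.
Qed.

(** A truncated geometric series approximates 1 / (z - r) for each root r
    outside of the disc, uniformly on the disc. *)
Lemma approx_inverse (s : seq C) rho eps : 0 <= rho -> 0 < eps ->
    (forall r, r \in s -> rho < cabs r) ->
  exists q : {poly C}, forall z, cabs z <= rho ->
    cabs (q.[z] * \prod_(r <- s) (z - r) - 1) <= eps.
Proof.
move=> rho0; elim: s eps => [|r s IH] eps eps0 hs.
  by exists 1 => z _; rewrite big_nil hornerC mulr1 subrr cabs0 ltW.
have r_rho : rho < cabs r by apply: hs; rewrite inE eqxx.
have r0 : 0 < cabs r := le_lt_trans rho0 r_rho.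
have rn0 : r != 0 by apply/eqP => e; move: r0; rewrite e cabs0 ltxx.
have e2 : 0 < eps / 2 by rewrite divr_gt0.
have [q hq] := IH _ e2 (fun x xs => hs x (mem_behead (s := r :: s) xs)).
have [N hN] : exists N, (1 + eps / 2) * (rho / cabs r) ^+ N <= eps / 2.
  have [->|rhon0] := eqVneq rho 0.
    by exists 1%N; rewrite mul0r expr1 mulr0 ltW.
  have rho_gt0 : 0 < rho by rewrite lt_def rhon0.
  have q1 : 1 < cabs r / rho by rewrite ltr_pdivlMr// mul1r.
  have [N hN] := expr_large ((1 + eps / 2) / (eps / 2)) q1.
  exists N; have := hN N (leqnn N); rewrite ler_pdivrMr// => h.
  rewrite -[rho / _]invrK invf_div exprVn ler_pdivrMr ?exprn_gt0 ?divr_gt0//.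
  by rewrite [leRHS]mulrC.
pose g : {poly C} := - r^-1%:P * \sum_(k < N) (r^-1 *: 'X) ^+ k.
exists (q * g) => z zr; rewrite big_cons.
have gE : g.[z] * (z - r) = 1 - (z / r) ^+ N.
  have -> : g.[z] = - r^-1 * \sum_(k < N) (z / r) ^+ k.
    rewrite /g hornerM hornerN hornerC horner_sum; congr (_ * _).
    by apply: eq_bigr => k _; rewrite horner_exp hornerZ hornerX mulrC.
  have h := subrX1 (z / r) N.
  rewrite -[1 - _]opprB h mulNr mulNr mulrAC; congr (- _).
  by rewrite mulrBr [r^-1 * z]mulrC mulVf.
rewrite hornerM.
have -> : q.[z] * g.[z] * ((z - r) * \prod_(j <- s) (z - j)) - 1 =
   (q.[z] * \prod_(j <- s) (z - j) - 1) -
   (q.[z] * \prod_(j <- s) (z - j)) * (z / r) ^+ N.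
  set p := \prod_(_ <- _) _.
  have -> : q.[z] * g.[z] * ((z - r) * p) = q.[z] * p * (g.[z] * (z - r)) by
    ring.
  by rewrite gE; ring.
have hz := hq _ zr; set u := q.[z] * _ in hz *.
apply: le_trans (cabsD _ _) _; rewrite cabsN cabsM cabsX cabsM cabsV.
rewrite [leRHS](splitr eps); apply: lerD => //; apply: le_trans hN.
apply: ler_pM; rewrite ?cabs_ge0 ?exprn_ge0 ?divr_ge0 ?cabs_ge0//.
  by rewrite -[u](subrK 1); apply: le_trans (cabsD _ _) _;
    rewrite cabs1 addrC lerD2l.
by rewrite lerXn2r ?nnegrE ?divr_ge0 ?cabs_ge0// ler_pM2r ?invr_gt0.
Qed.

(** With q a polynomial approximation of 1 / P, [coef1_le] applies to q and to
    q P - 1.  The linear coefficient of q P then gives the bound; the factor 4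
    instead of 1 comes from the error 1/2 allowed in the approximation. *)
Lemma cauchy_inverse0 (P : {poly C}) rho m : 0 <= rho -> 0 < m ->
    (forall z, cabs z <= rho -> m <= cabs P.[z]) ->
  cabs P^`().[0] * (rho * m) <= 4 * cabs P.[0] ^+ 2.
Proof.
move=> rho0 m0 hP.
have z0 : cabs (0 : C) <= rho by rewrite cabs0.
have Pn0 : P != 0.
  by apply/eqP => e; have := hP 0 z0; rewrite e horner0 cabs0 leNgt m0.
have lc0 : lead_coef P != 0 by rewrite lead_coef_eq0.
have [s eP] := closed_field_poly_normal P.
have hs r : r \in s -> rho < cabs r.
  move=> rs; rewrite ltNge; apply/negP => /hP; rewrite eP hornerZ horner_prod.
  rewrite (big_rem r)//= hornerXsubC subrr mul0r mulr0 cabs0 leNgt m0//.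
have half0 : (0 : R) < 2^-1 by rewrite invr_gt0.
have [q0 hq0] := approx_inverse rho0 half0 hs.
pose q := (lead_coef P)^-1 *: q0; pose e := q * P - 1.
have he z : cabs z <= rho -> cabs e.[z] <= 2^-1.
  move=> zr; rewrite /e hornerD hornerN hornerC hornerM /q hornerZ.
  suff -> : (lead_coef P)^-1 * q0.[z] * P.[z] =
     q0.[z] * \prod_(r <- s) (z - r) by apply: hq0.
  rewrite {2}eP hornerZ horner_prod.
  under eq_bigr do rewrite hornerXsubC.
  by rewrite mulrAC mulrA mulVf// mul1r mulrC.
have P_pos z : cabs z <= rho -> 0 < cabs P.[z] by move=> /hP;
  apply: lt_le_trans.
have hq z : cabs z <= rho -> cabs q.[z] <= 3 / 2 / m.
  move=> zr; have hz := he z zr; have Pz := P_pos z zr.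
  have : cabs (q.[z] * P.[z]) <= 3 / 2.
    have -> : q.[z] * P.[z] = e.[z] + 1.
      by rewrite /e hornerD hornerN hornerC subrK hornerM.
    apply: le_trans (cabsD _ _) _; rewrite cabs1; lra.
  rewrite cabsM => h; rewrite ler_pdivlMr//; apply: le_trans h.
  by rewrite ler_wpM2l ?cabs_ge0 ?hP.
have he1 := coef1_le rho0 he.
have hq1 := coef1_le rho0 hq.
have e1E : e`_1 = q`_0 * P`_1 + q`_1 * P`_0.
  by rewrite /e coefB coef1 subr0 coefM !big_ord_recl big_ord0 addr0.
have P1E : P^`().[0] = P`_1 by rewrite horner_coef0 coef_deriv mulr1n.
have he0 := he 0 z0; rewrite horner_coef0 /e coefB coef1 coef0M in he0.
rewrite P1E horner_coef0.
set p0 := cabs P`_0; set p1 := cabs P`_1.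
have mp0 : m <= p0 by have := hP 0 z0; rewrite horner_coef0.
have h1 : cabs (q`_0 * P`_1) * rho <= 2^-1 + 3 / 2 / m * p0.
  have -> : q`_0 * P`_1 = e`_1 - q`_1 * P`_0 by rewrite e1E addrK.
  apply: le_trans (ler_wpM2r rho0 (cabsD _ _)) _.
  rewrite cabsN mulrDl lerD// cabsM mulrAC.
  by rewrite ler_wpM2r ?cabs_ge0.
have h2 : 2^-1 <= cabs (q`_0) * p0.
  rewrite -cabsM; have := cabsD (q`_0 * P`_0) (1 - q`_0 * P`_0).
  rewrite addrC subrK cabs1 [cabs (1 - _)]cabsB; lra.
rewrite cabsM -/p1 in h1.
have p00 : 0 < p0 := lt_le_trans m0 mp0.
have p10 : 0 <= p1 by apply: cabs_ge0.
have h3 : 2^-1 * (p1 * rho) <= (2^-1 + 3 / 2 / m * p0) * p0.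
  apply: le_trans (ler_wpM2r (mulr_ge0 p10 rho0) h2) _.
  have := ler_wpM2r (ltW p00) h1; lra.
have h4 := ler_wpM2r (ltW m0) h3.
have h5 : (2^-1 + 3 / 2 / m * p0) * p0 * m = 2^-1 * m * p0 + 3 / 2 * p0 ^+ 2.
  by field; rewrite gt_eqF.
rewrite h5 in h4.
have := ler_wpM2r (ltW p00) mp0; rewrite expr2 in h4 *; lra.
Qed.

Lemma cauchy_inverse (P : {poly C}) (z0 : C) rho m : 0 <= rho -> 0 < m ->
    (forall z, cabs (z - z0) <= rho -> m <= cabs P.[z]) ->
  cabs P^`().[z0] * (rho * m) <= 4 * cabs P.[z0] ^+ 2.
Proof.
move=> rho0 m0 hP; have := @cauchy_inverse0 (P \Po ('X + z0%:P)) rho m rho0 m0.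
rewrite deriv_comp derivD derivX derivC addr0 mulr1 !horner_comp.
rewrite hornerD hornerX hornerC add0r; apply=> z zr.
by rewrite horner_comp hornerD hornerX hornerC hP// addrK.
Qed.

End CauchyEstimate.

(** * Topology of the plane through the modulus *)

Section PlaneTopology.
Variable R : realType.
Local Notation C := R[i].

Lemma pos_complex (e : C) : 0 < e -> e = (complex.Re e)%:C.
Proof. by case: e => a b; rewrite ltcE /= => /andP[/eqP -> _]. Qed.

Lemma nbhs_cabs (z : R[i]^o) (U : set R[i]^o) :
  nbhs z U <-> exists2 r : R, 0 < r & forall w : C, cabs (w - z) < r -> U w.
Proof.
split=> [/nbhs_ballP[e /= e0 eU]|[r r0 rU]].
  have er : e = (complex.Re e)%:C by apply: pos_complex.
  rewrite er in e0 eU; rewrite ltcR in e0.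
  exists (complex.Re e) => // w wz; apply: eU.
  by rewrite -ball_normE/= normrC ltcR cabsB.
apply/nbhs_ballP; exists r%:C; rewrite /= ?ltcR// => w.
by rewrite -ball_normE/= normrC ltcR cabsB => /rU.
Qed.

Lemma uniform_cvg_cabs (K : set R[i]^o) (h : nat -> R[i]^o -> R[i]^o)
    (phi : R[i]^o -> R[i]^o) :
  {uniform K, h n @[n --> \oo] --> phi} <->
  forall eps : R, 0 < eps -> exists N, forall n, (N <= n)%N ->
    forall z, K z -> cabs (h n z - phi z) < eps.
Proof.
split=> [hcv eps eps0|hcv].
  have : nbhs (phi : {uniform` K -> R[i]^o})
    [set g | forall z, K z -> cabs (g z - phi z) < eps].
    apply/uniform_nbhs; exists [set xy | ball xy.1 eps%:C xy.2]; split.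
      have e0 : 0 < eps%:C by rewrite ltcR.
      exact: (@entourage_ball _ _ (PosNum e0)).
    move=> g hg z /hg /=; rewrite -ball_normE /= normrC ltcR cabsB//.
  by move=> /hcv[N _ hN]; exists N => n Nn; apply: hN.
move=> P /uniform_nbhs [E [entE EP]].
move: entE; rewrite -entourage_ballE => -[e /= e0 eE].
have er : e = (complex.Re e)%:C by apply: pos_complex.
have re0 : 0 < complex.Re e by rewrite -ltcR -er.
have [N hN] := hcv _ re0.
exists N => // n /= /hN hn; apply: EP => z Kz; apply: eE.
by rewrite /= -ball_normE/= normrC er ltcR cabsB hn.
Qed.

End PlaneTopology.

(** * The Julia set of a polynomial *)

Section Julia.
Variable R : realType.
Local Notation C := R[i].

Lemma bounded_cluster (u : nat -> C) M : (forall n, cabs (u n) <= M) ->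
  exists x : C, forall r, 0 < r ->
    forall N, exists2 n, (N <= n)%N & cabs (u n - x) < r.
Proof.
move=> uM; pose v n := (complex.Re (u n), complex.Im (u n)).
have cpt : compact (`[- M, M]%classic `*` `[- M, M]%classic : set (R * R)).
  by apply: compact_setX; apply: segment_compact.
have [|[x y] [_ cl]] := cpt (v @ \oo) _.
  exists 0%N => // n _; split; rewrite /= in_itv /= -ler_norml.
    by rewrite (le_trans (Re_le_cabs _) (uM _)).
  by rewrite (le_trans (Im_le_cabs _) (uM _)).
exists (Complex x y) => r r0 N.
have r2 : 0 < r / 2 by rewrite divr_gt0.
have [||[a b] [[n /= Nn [<- <-]] [/= hx hy]]] :=
    cl [set p | exists2 n, (N <= n)%N & v n = p]
       (ball x (r / 2) `*` ball y (r / 2)).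
- by exists N => // n /= Nn; exists n.
- by exists (ball x (r / 2), ball y (r / 2)) => //; split; apply: nbhsx_ballx.
exists n => //; apply: le_lt_trans (cabs_le_ReIm _) _.
move: hx hy; rewrite -!ball_normE /v /=; case: (u n) => a' b' /= hx hy.
by rewrite [ltRHS]splitr ltrD// distrC.
Qed.

Lemma closed_disc_compact (z : C) r :
  compact [set w : R[i]^o | cabs (z - w) <= r].
Proof.
pose mk (p : R * R) : R[i]^o := Complex p.1 p.2.
have mk_cont : continuous mk.
  move=> p V /nbhs_cabs[e e0 eV].
  have e2 : 0 < e / 2 by rewrite divr_gt0.
  exists (ball p.1 (e / 2), ball p.2 (e / 2)).
    by split; apply: nbhsx_ballx.
  move=> q [/=]; rewrite -!ball_normE /= => h1 h2; apply: eV.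
  apply: le_lt_trans (cabs_le_ReIm _) _.
  by rewrite [ltRHS]splitr ltrD// distrC.
pose M := cabs z + r.
have cpt : compact (mk @` (`[- M, M]%classic `*` `[- M, M]%classic)).
  apply: continuous_compact; first by apply: continuous_subspaceT.
  by apply: compact_setX; apply: segment_compact.
apply: subclosed_compact cpt _.
  rewrite -[X in closed X]setCK; apply: open_closedC;
    rewrite openE => w /= /negP.
  rewrite -ltNge => zw; apply/nbhs_cabs; exists (cabs (z - w) - r).
    by rewrite subr_gt0.
  move=> v vw /= zv; have := cabs_triangle v z w; lra.
move=> w /= zw; exists (complex.Re w, complex.Im w); last by case: w zw.
have wM : cabs w <= M.
  have := cabs_triangle z w 0; rewrite !subr0 cabsB /M; lra.
split; rewrite /= in_itv /= -ler_norml.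
  exact: le_trans (Re_le_cabs _) wM.
exact: le_trans (Im_le_cabs _) wM.
Qed.

Lemma dependent_subsequence (P : nat -> nat -> Prop) :
    (forall n N, exists2 m, (N <= m)%N & P n m) ->
  exists2 s : nat -> nat, {homo s : m n / (m < n)%N} & forall n, P n (s n).
Proof.
move=> hP; have [g hg] : exists g : nat -> nat -> nat,
    forall n N, (N <= g n N)%N /\ P n (g n N).
  have h n : exists gn : nat -> nat, forall N, (N <= gn N)%N /\ P n (gn N).
    have h N : exists m, (N <= m)%N /\ P n m by have [m ? ?] := hP n N;
      exists m.
    by have [gn hgn] := choice h; exists gn.
  by have [g hg] := choice h; exists g.
pose s := fix s n := if n is k.+1 then g k.+1 (s k).+1 else g 0%N 0%N.
exists s; last by case=> [|n] /=; apply: (hg _ _).2.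
apply: homo_ltn => [y x z|n]; first exact: ltn_trans.
exact: (hg _ _).1.
Qed.

Lemma nat_subsequence (k : nat -> nat) :
  exists2 s : nat -> nat, {homo s : m n / (m < n)%N} &
    (exists c, forall n, k (s n) = c) \/ (forall n, (n <= k (s n))%N).
Proof.
have [[c hc]|hno] := pselect (exists c, forall N, exists2 n, (N <= n)%N &
  k n = c).
  have [s s_homo hs] := @dependent_subsequence (fun _ m => k m = c) (fun _ =>
    hc).
  by exists s => //; left; exists c.
have large n : exists N, forall m, (N <= m)%N -> (n <= k m)%N.
  elim: n => [|n [N hN]]; first by exists 0%N.
  have [N' hN'] : exists N', forall m, (N' <= m)%N -> k m <> n.
    apply: contrapT => h; apply: hno; exists n => N'.
    apply: contrapT => h'; apply: h; exists N' => m N'm e; apply: h';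
      by exists m.
  exists (maxn N N') => m; rewrite geq_max => /andP[h1 h2].
  by rewrite ltn_neqAle hN// andbT eq_sym; apply/eqP/hN'.
have [n N|s s_homo hs] := @dependent_subsequence (fun n m => (n <= k m)%N).
  have [N' hN'] := large n; exists (maxn N N'); first exact: leq_maxl.
  by apply: hN'; apply: leq_maxr.
by exists s => //; right.
Qed.

Variable f : {poly C}.
Hypothesis degf : (2 < size f)%N.

Let sf1 : (1 < size f)%N. Proof. exact: ltn_trans degf. Qed.

(** The leading term dominates, with exponent at least 2. *)
Lemma escape_radius : exists2 rad, 0 < rad &
  forall z : C, rad < cabs z -> 2 * cabs z <= cabs f.[z].
Proof.
set a := cabs (lead_coef f).
have a0 : 0 < a by rewrite cabs_gt0// lead_coef_eq0 -size_poly_gt0 ltnW// ltnW.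
have [k ek] : exists k, size f = k.+3 by exists (size f - 3)%N; move: degf; lia.
set B := \sum_(i < k.+2) cabs f`_i.
have B0 : 0 <= B by apply: sumr_ge0 => i _; apply: cabs_ge0.
exists ((B + 2) / a + 1); first by rewrite ltr_wpDl// divr_ge0 ?addr_ge0// ltW.
move=> z hz; set r := cabs z in hz *.
have r1 : 1 <= r.
  by apply: le_trans (ltW hz); rewrite lerDr divr_ge0 ?addr_ge0// ltW.
have ar : B + 2 <= a * r.
  rewrite mulrC -ler_pdivrMr//; apply: le_trans (ltW hz); by rewrite lerDl.
have low : cabs (\sum_(i < k.+2) f`_i * z ^+ i) <= B * r ^+ k.+1.
  rewrite mulr_suml; apply: (@le_trans _ _ (\sum_(i < k.+2) cabs (f`_i * z ^+
    i))).
    elim/big_ind2: _ => [|x1 x2 y1 y2 h1 h2|//]; first by rewrite cabs0.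
    by apply: le_trans (cabsD _ _) _; apply: lerD.
  apply: ler_sum => i _; rewrite cabsM cabsX ler_wpM2l ?cabs_ge0//.
  by rewrite ler_weXn2l// -ltnS.
have e : f.[z] = \sum_(i < k.+2) f`_i * z ^+ i + lead_coef f * z ^+ k.+2.
  by rewrite horner_coef ek big_ord_recr /= lead_coefE ek.
have top : a * r ^+ k.+2 <= cabs f.[z] + B * r ^+ k.+1.
  have -> : a * r ^+ k.+2 = cabs (f.[z] - \sum_(i < k.+2) f`_i * z ^+ i).
    by rewrite e addrAC subrr add0r cabsM cabsX.
  by apply: le_trans (cabsD _ _) _; rewrite cabsN lerD2l.
have rk : r <= r ^+ k.+1 by rewrite -[leLHS]expr1 ler_weXn2l.
have rk0 : 0 <= r ^+ k.+1 by rewrite exprn_ge0// cabs_ge0.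
rewrite exprS mulrA in top.
have := ler_wpM2r rk0 ar; lra.
Qed.

Definition iter_poly n : {poly C} := iter n (fun p => f \Po p) 'X.

Lemma iter_polyE n z : (iter_poly n).[z] = iter n (horner f) z.
Proof. by elim: n => [|n IH] /=; rewrite ?hornerX// horner_comp IH. Qed.

Lemma iter_poly_deriv n z :
  (iter_poly n)^`().[z] = \prod_(i < n) f^`().[iter i (horner f) z].
Proof.
elim: n => [|n IH]; first by rewrite /= derivX hornerC big_ord0.
by rewrite big_ord_recr /= deriv_comp hornerM IH horner_comp iter_polyE mulrC.
Qed.

(** An iterate f^k with k > 0 is f^(k-1) composed with f, so a subsequence for
    f^(k-1) near f(z) is one for f^k near z; the sequences in which
    k is constant along a subsequence are treated apart. *)
Lemma fatou_preimage (z : C) : fatou_set f f.[z] -> fatou_set f z.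
Proof.
move=> [U [oU Uz] nU].
have contf : continuous (fun w : R[i]^o => f.[w] : R[i]^o).
  move=> w V /nbhs_cabs[r r0 rV]; apply/nbhs_cabs.
  have [B B0 hB] := @poly_lipschitz R f (cabs w + 1) (addr_ge0 (cabs_ge0 _)
    ler01).
  exists (Num.min 1 (r / (B + 1))).
    by rewrite lt_min ltr01 divr_gt0// ltr_wpDl.
  move=> v; rewrite lt_min => /andP[h1 h2]; apply: rV.
  apply: le_lt_trans (hB _ _ _ _) _; first by rewrite lerDl.
    rewrite -[v](subrK w) addrC; apply: le_trans (cabsD _ _) _.
    by rewrite lerD2l ltW.
  move: h2; rewrite ltr_pdivlMr ?ltr_wpDl// mulrDr mulr1 mulrC;
    apply: le_lt_trans.
  by rewrite lerDl cabs_ge0.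
exists ((fun w : R[i]^o => f.[w] : R[i]^o) @^-1` U).
  by split => //; apply: open_comp => // x _; apply: contf.
move=> h hh; have hk n : exists k, h n = iterate f k.
  by have [k _ <-] := hh n; exists k.
have [k kE] := choice hk.
have [s1 s1_homo [[c hc]|hs1]] := nat_subsequence k.
  exists s1 => //; left; exists (iterate f c) => K _ _.
  apply/uniform_cvg_cabs => eps eps0; exists 0%N => n _ z' _.
  by rewrite kE hc subrr cabs0.
(* The shift by one in the index makes the exponent positive. *)
pose h' n := iterate f (k (s1 n.+1)).-1.
have hE n w : h (s1 n.+1) w = h' n f.[w].
  rewrite kE /h' /iterate; have := hs1 n.+1.
  by case: (k _) => // m _; rewrite /= -iterS iterSr.
have [|s s_homo hs] := nU h'; first by move=> n; exists (k (s1 n.+1)).-1.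
exists (fun n => s1 (s n).+1); first by move=> m n mn; rewrite s1_homo//
  ltnS s_homo.
have img (K : set R[i]^o) : compact K ->
   K `<=` (fun w : R[i]^o => f.[w] : R[i]^o) @^-1` U ->
   compact ((fun w : R[i]^o => f.[w] : R[i]^o) @` K) /\
   (fun w : R[i]^o => f.[w] : R[i]^o) @` K `<=` U.
  move=> cK KU; split; last by move=> _ [w Kw <-]; apply: KU.
  by apply: continuous_compact => //; apply: continuous_subspaceT.
case: hs => [[phi hphi]|hinf]; [left|right].
  exists (fun w => phi f.[w]) => K cK KU; apply/uniform_cvg_cabs => eps eps0.
  have [cK' KU'] := img K cK KU.
  have /uniform_cvg_cabs/(_ eps eps0)[N hN] := hphi _ cK' KU'.
  by exists N => n Nn w Kw; rewrite hE; apply: hN => //; exists w.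
move=> K cK KU M; have [cK' KU'] := img K cK KU.
have [N _ hN] := hinf _ cK' KU' M.
by exists N => // n Nn w Kw; rewrite hE; apply: (hN n Nn); exists w.
Qed.

(** By [root_near] a disc about f(z) is the image of points in a closed disc
    about z on which the iterates have a subsequence; f^(k+1) = f^k o f
    transports convergence. *)
Lemma fatou_image (z : C) : fatou_set f z -> fatou_set f f.[z].
Proof.
move=> [U [oU Uz] nU].
have /nbhs_cabs[r r0 rU] : nbhs (z : R[i]^o) U by apply: open_nbhs_nbhs.
have r2 : 0 < r / 2 by rewrite divr_gt0.
set r' := cabs (lead_coef f) * (r / 2) ^+ (size f).-1.
have r'0 : 0 < r'.
  rewrite mulr_gt0 ?exprn_gt0// cabs_gt0// lead_coef_eq0 -size_poly_gt0.
  by rewrite ltnW.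
have hpre (y : C) : exists w : C, cabs (y - f.[z]) < r' ->
  cabs (z - w) <= r / 2 /\ f.[w] = y.
  have [h|h] := pselect (cabs (y - f.[z]) < r'); last by exists 0.
  have [|w wy zw] := root_near (w := z) (y := y) sf1 r2.
    by rewrite cabsB ltW.
  by exists w.
have [pre preP] := choice hpre.
pose V : set R[i]^o := [set y | cabs (y - f.[z]) < r'].
have Vopen : open V.
  rewrite openE => y /= Vy; apply/nbhs_cabs; exists (r' - cabs (y - f.[z])).
    by rewrite subr_gt0.
  move=> w wy; rewrite /V /=; apply: le_lt_trans (cabs_triangle y _ _) _.
  by rewrite -ltrBrDr.
exists V; first by split=> //; rewrite /V /= subrr cabs0.
pose K' : set R[i]^o := [set w | cabs (z - w) <= r / 2].
have K'U : K' `<=` U.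
  move=> w /= zw; apply: rU; rewrite cabsB; apply: le_lt_trans zw _.
  by rewrite gtr_pMr// invf_lt1// ltr1n.
have cK' : compact K' by apply: closed_disc_compact.
move=> h hh; have hk n : exists k, h n = iterate f k.
  by have [k _ <-] := hh n; exists k.
have [k kE] := choice hk.
pose h' n := iterate f (k n).+1.
have hE n w : h' n w = h n f.[w] by rewrite kE /h' /iterate iterSr.
have [|s s_homo hs] := nU h'; first by move=> n; exists (k n).+1.
exists s => //.
case: hs => [[phi hphi]|hinf]; [left|right].
  exists (fun y => phi (pre y)) => K cK KV; apply/uniform_cvg_cabs => eps eps0.
  have /uniform_cvg_cabs/(_ eps eps0)[N hN] := hphi _ cK' K'U.
  exists N => n Nn y Ky; have [zw wy] := preP y (KV y Ky).
  by rewrite -{1}wy -hE; apply: hN.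
move=> K cK KV M; have [N _ hN] := hinf _ cK' K'U M.
exists N => // n Nn y Ky; have [zw wy] := preP y (KV y Ky).
by rewrite -wy -hE; apply: (hN n Nn).
Qed.

(** Near infinity a sequence of iterates either tends to infinity uniformly
    along a subsequence or has a constant subsequence. *)
Lemma julia_bounded :
  exists2 M, 0 < M & forall z : C, julia_set f z -> cabs z <= M.
Proof.
have [rad rad0 hrad] := escape_radius; exists rad => // z jz.
rewrite leNgt; apply/negP => zr; apply: jz.
pose U : set R[i]^o := [set w | rad < cabs w].
exists U.
  split=> //; rewrite openE => w /= Uw; apply/nbhs_cabs;
    exists (cabs w - rad); first by rewrite subr_gt0.
  move=> v vw; rewrite /U /=; have := cabs_triangle v w 0.
  rewrite !subr0 cabsB; lra.
move=> h hh; have hk n : exists k, h n = iterate f k.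
  by have [k _ <-] := hh n; exists k.
have [k kE] := choice hk.
have [s s_homo [[c hc]|hs]] := nat_subsequence k; exists s => //.
  left; exists (iterate f c) => K _ _.
  apply/uniform_cvg_cabs => eps eps0; exists 0%N => n _ z' _.
  by rewrite kE hc subrr cabs0.
right=> K _ KU M.
have grow n w : rad < cabs w -> 2 ^+ n * rad < cabs (iter n (horner f) w) /\
    rad < cabs (iter n (horner f) w).
  move=> Uw; elim: n => [|n [IH1 IH2]]; first by rewrite expr0 mul1r.
  have h2 : 2 * cabs (iter n (horner f) w) <= cabs (iter n.+1 (horner f) w).
    exact: hrad.
  split; last by move: rad0 IH2 h2; lra.
  rewrite exprS -mulrA; apply: lt_le_trans h2; by rewrite ltr_pM2l.
have [N hN] := expr_large (M / rad) (ltr1n R 2).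
exists N => // n /= Nn w Kw; rewrite kE.
apply: le_lt_trans (grow _ _ (KU w Kw)).1.
by rewrite -ler_pdivrMr//; apply: hN; apply: leq_trans (hs n).
Qed.

Lemma julia_closed (z : C) :
    (forall r, 0 < r -> exists2 w, julia_set f w & cabs (w - z) < r) ->
  julia_set f z.
Proof.
move=> h [U [oU Uz] nU].
have /nbhs_cabs[r r0 rU] : nbhs (z : R[i]^o) U by apply: open_nbhs_nbhs.
by have [w jw wz] := h r r0; apply: jw; exists U => //; split=> //; apply: rU.
Qed.

Lemma julia_image (z : C) : julia_set f z -> julia_set f f.[z].
Proof. by move=> jz /fatou_preimage. Qed.

Lemma julia_preimage (z : C) : julia_set f f.[z] -> julia_set f z.
Proof. by move=> jz /fatou_image. Qed.

End Julia.

(** * The expanding system of an expanding polynomial *)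

Lemma upper_distortion (R : realType) (w t A B B1 : R) :
  1 <= w -> 0 <= t -> 0 <= B -> 0 <= B1 -> A <= w * t + B * t ^+ 2 ->
  A <= w * t * (1 + (2 * B + B1) * t).
Proof.
move=> w1 t0 B0 B10 h; apply: le_trans h _; rewrite mulrDr mulr1 lerD2l.
have -> : w * t * ((2 * B + B1) * t) = w * (2 * B + B1) * t ^+ 2 by ring.
rewrite ler_wpM2r ?sqr_ge0//.
have : 2 * B + B1 <= w * (2 * B + B1) by rewrite ler_peMl// addr_ge0// mulr_ge0.
lra.
Qed.

Lemma lower_distortion (R : realType) (w t A B B1 : R) :
  1 <= w -> 0 <= t -> 0 <= A -> 0 <= B -> 0 <= B1 -> B * t <= 2^-1 ->
  w * t <= A + B * t ^+ 2 -> w * t <= A * (1 + (2 * B + B1) * t).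
Proof.
move=> w1 t0 A0 B0 B10 Bt h.
have h1 : t <= w * t by rewrite ler_peMl.
have h2 : B * t ^+ 2 <= 2^-1 * t by rewrite expr2 mulrA ler_wpM2r.
have h3 : 2^-1 * t <= A by lra.
have Bt0 : 0 <= 2 * B * t by rewrite !mulr_ge0.
have h4 := ler_wpM2r Bt0 h3.
have h5 : 0 <= A * B1 * t by rewrite !mulr_ge0.
rewrite expr2 in h; lra.
Qed.

Section JuliaSystem.
Variables (R : realType) (f : {poly R[i]}).
Hypothesis degf : (2 < size f)%N.
Hypothesis expf : forall z : R[i]^o, julia_set f z -> 1 < cabs f^`().[z].
Local Notation C := R[i].
Local Notation J := (julia_set f).
Local Notation F := (horner f).

Let sf1 : (1 < size f)%N. Proof. exact: ltn_trans degf. Qed.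

Lemma julia_iter n (z : C) : J z -> J (iter n F z).
Proof. by move=> jz; elim: n => //= n IH; apply: julia_image. Qed.

Lemma julia_cluster (u : nat -> C) : (forall n, J (u n)) ->
  exists2 x : C, J x & forall r, 0 < r ->
    forall N, exists2 n, (N <= n)%N & cabs (u n - x) < r.
Proof.
move=> hu; have [M M0 hM] := julia_bounded degf.
have [x hx] := bounded_cluster (fun n => hM _ (hu n)).
exists x => //; apply: julia_closed => r r0.
by have [n _ hn] := hx r r0 0%N; exists (u n).
Qed.

(** Otherwise a sequence in J along which the modulus of f' tends to 1 or less
    would cluster at a point of J, where it is greater than 1. *)
Lemma uniform_expansion : exists2 lam, 1 < lam &
  forall z : C, J z -> lam <= cabs f^`().[z].
Proof.
apply: contrapT => hno; have [M M0 hM] := julia_bounded degf.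
have h n : exists z : C, J z /\ cabs f^`().[z] < 1 + n.+1%:R^-1.
  apply: contrapT => h; apply: hno; exists (1 + n.+1%:R^-1).
    by rewrite ltrDl invr_gt0.
  by move=> z jz; rewrite leNgt; apply/negP => hz; apply: h; exists z.
have [u hu] := choice h.
have [x jx hx] := julia_cluster (fun n => (hu n).1).
have [B B0 hB] := poly_lipschitz f^`() (ltW M0).
set g := cabs f^`().[x] - 1.
have g0 : 0 < g by rewrite subr_gt0 expf.
have r0 : 0 < g / 2 / (B + 1) by rewrite !divr_gt0// ltr_wpDl.
have [n Nn hn] := hx _ r0 (Num.truncn (2 / g)).+1.
have h1 := hB _ _ (hM _ (hu n).1) (hM _ jx).
have h2 := (hu n).2.
have h3 : n.+1%:R^-1 <= g / 2.
  rewrite -[leRHS]invrK lef_pV2 ?posrE ?invr_gt0 ?divr_gt0// invf_div.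
  by apply: ltW; apply: lt_le_trans (truncnS_gt _) _; rewrite ler_nat leqW.
have h4 : B * cabs (x - u n) <= g / 2.
  apply: (@le_trans _ _ ((B + 1) * cabs (x - u n))).
    by rewrite ler_wpM2r ?cabs_ge0// lerDl.
  by rewrite mulrC -ler_pdivlMr ?ltr_wpDl// cabsB ltW.
have h5 := cabsD (f^`().[x] - f^`().[u n]) f^`().[u n].
rewrite subrK in h5.
have : cabs f^`().[x] < cabs f^`().[x].
  apply: le_lt_trans h5 _; apply: le_lt_trans (lerD (le_trans h1 h4) (lexx _))
    _.
  apply: lt_le_trans (_ : g / 2 + (1 + g / 2) <= _).
    by rewrite ltrD2l; apply: lt_le_trans h2 _; rewrite lerD2l.
  by rewrite /g; lra.
by rewrite ltxx.
Qed.

(** The radius s is so small that the quadratic error in Taylor's formula is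
    at most (l0 - 1) / 2 times the distance, for l0 > 1 a lower bound of
    the modulus of f' on J. *)
Lemma expanding_neighbourhood : exists lam s B B1, [/\ 1 < lam, 0 < s,
    0 <= B & 0 <= B1] /\ [/\ B * s <= 2^-1,
    (forall z : C, J z -> lam <= cabs f^`().[z]),
    (forall x y : C, J x -> cabs (y - x) <= s ->
      cabs (f.[y] - f.[x] - f^`().[x] * (y - x)) <= B * cabs (y - x) ^+ 2),
    (forall x y : C, J x -> cabs (y - x) <= s ->
      lam * cabs (y - x) <= cabs (f.[y] - f.[x])) &
    (forall x y : C, J x -> J y ->
      cabs (f^`().[y] - f^`().[x]) <= B1 * cabs (y - x))].
Proof.
have [M M0 hM] := julia_bounded degf.
have [l0 l01 hl0] := uniform_expansion.
have M1 : 0 <= M + 1 by rewrite addr_ge0// ltW.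
have [B B0 hB] := poly_taylor f M1.
have [B1 B10 hB1] := poly_lipschitz f^`() (ltW M0).
pose lam := (1 + l0) / 2.
have lam1 : 1 < lam by rewrite /lam; lra.
have lam_l0 : lam <= l0 by rewrite /lam; lra.
pose b := Num.min 2^-1 (l0 - lam).
have b0 : 0 < b by rewrite lt_min invr_gt0 ltr0n /= subr_gt0 /lam; lra.
pose s := Num.min 1 (b / (B + 1)).
have s0 : 0 < s by rewrite lt_min ltr01 divr_gt0// ltr_wpDl.
have s1 : s <= 1 by rewrite ge_min lexx.
have Bs : B * s <= b.
  have sb : s <= b / (B + 1) by rewrite ge_min lexx orbT.
  rewrite ler_pdivlMr ?ltr_wpDl// in sb.
  by apply: le_trans sb; rewrite mulrDr mulr1 mulrC lerDl ltW.
have Taylor (x y : C) : J x -> cabs (y - x) <= s ->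
   cabs (f.[y] - f.[x] - f^`().[x] * (y - x)) <= B * cabs (y - x) ^+ 2.
  move=> jx xy; apply: hB; first by rewrite (le_trans (hM _ jx))// lerDl.
  rewrite -[y](subrK x) addrC; apply: le_trans (cabsD _ _) _.
  by rewrite lerD ?hM// (le_trans xy).
exists lam, s, B, B1; split=> //; split=> //.
- by apply: le_trans Bs _; rewrite ge_min lexx.
- by move=> z jz; apply: le_trans lam_l0 (hl0 _ jz).
- move=> x y jx xy; have h1 := Taylor _ _ jx xy; have h2 := hl0 _ jx.
  set t := cabs (y - x) in xy h1 *; have t0 : 0 <= t by apply: cabs_ge0.
  have h3 : cabs (f^`().[x] * (y - x)) <=
      cabs (f.[y] - f.[x]) + cabs (f.[y] - f.[x] - f^`().[x] * (y - x)).
    rewrite -[cabs (_ - _ * _)]cabsN; apply: le_trans (cabsD _ _).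
    by rewrite opprB [X in _ <= cabs X]addrC subrK.
  rewrite cabsM -/t in h3.
  have h4 : B * t ^+ 2 <= (l0 - lam) * t.
    rewrite expr2 mulrA ler_wpM2r//; apply: le_trans (ler_wpM2l B0 xy) _.
    by apply: le_trans Bs _; rewrite ge_min lexx orbT.
  have h5 := ler_wpM2r t0 h2; lra.
by move=> x y jx jy; apply: hB1; apply: hM.
Qed.

Definition jpoint (z : C) (jz : J z) : set_type J := SigSub (mem_set jz).

Lemma jpointP (x : set_type J) : J (val x).
Proof. exact: set_mem (valP x). Qed.
Arguments jpointP x : clear implicits.

Definition jmap (x : set_type J) : set_type J :=
  jpoint (julia_image (jpointP x)).
Definition jdist (x y : set_type J) : R := cabs (val x - val y).
Definition jderiv (x : set_type J) : R := cabs f^`().[val x].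

Lemma val_iter_jmap n x : val (iter n jmap x) = iter n F (val x).
Proof. by elim: n => //= n ->. Qed.

(** Exactness is proved by contradiction: were there no n-th preimage of y in
    the ball of radius r about x, then f^n - y would have no value smaller
    than del on the disc of radius r / 2, as such a value could be pulled back
    to a preimage of y (here the starting point need not be in J), and
    [cauchy_inverse] would bound the derivative of f^n at x, which is at
    least lam^n. *)
Lemma julia_expanding_system :
  exists lam L c del, expanding_system jdist jmap jderiv lam L c del.
Proof.
have [lam [s [B [B1 [[lam1 s0 B0 B10] [Bs hlam Taylor expand lip1]]]]]] :=
  expanding_neighbourhood.
have [M M0 hM] := julia_bounded degf.
have [L1 L10 hL1] := poly_bounded f^`() (ltW M0).
have [L2 L20 hL2] := poly_lipschitz f (ltW M0).
have lam0 : 0 < lam by lra.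
set a := cabs (lead_coef f).
have a0 : 0 < a by rewrite cabs_gt0// lead_coef_eq0 -size_poly_gt0 ltnW// ltnW.
pose del := Num.min s (a * s ^+ (size f).-1).
have del0 : 0 < del by rewrite lt_min s0 mulr_gt0// exprn_gt0.
have del_s : del <= s by rewrite ge_min lexx.
have del_a : del <= a * s ^+ (size f).-1 by rewrite ge_min lexx orbT.
have lift (w y : C) : J y -> cabs (f.[w] - y) <= del ->
    exists2 x : C, J x /\ f.[x] = y & lam * cabs (w - x) <= cabs (f.[w] - y).
  move=> jy hw; have [x xy wx] := root_near sf1 s0 (le_trans hw del_a).
  have jx : J x by apply: (julia_preimage degf); rewrite xy.
  by exists x => //; rewrite -xy; apply: expand.
have shadowC n (w y : C) : J y -> cabs (iter n F w - y) <= del ->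
    exists2 x : C, J x /\ iter n F x = y &
      lam ^+ n * cabs (w - x) <= cabs (iter n F w - y).
  move=> jy; elim: n w => [|n IH] w hw.
    by exists y => //; rewrite mul1r.
  rewrite iterSr in hw *; have [v [jv vy] hv] := IH _ hw.
  have hv' : cabs (f.[w] - v) <= del.
    apply: le_trans hw; apply: le_trans hv.
    by rewrite ler_peMl ?cabs_ge0// exprn_ege1// ltW.
  have [x [jx xv] hx] := lift _ _ jv hv'.
  exists x; first by split=> //; rewrite iterSr xv.
  rewrite exprSr -mulrA; apply: le_trans hv.
  by rewrite ler_pM2l ?exprn_gt0.
have w1 x : 1 <= jderiv x by apply: le_trans (ltW lam1) (hlam _ (jpointP x)).
have near x y : jdist x y <= del ->
    jdist (jmap x) (jmap y) <= jderiv x * jdist x y + B * jdist x y ^+ 2 /\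
    jderiv x * jdist x y <= jdist (jmap x) (jmap y) + B * jdist x y ^+ 2.
  move=> xy; have hT := Taylor _ (val y) (jpointP x).
  rewrite cabsB in hT; have {}hT := hT (le_trans xy del_s).
  rewrite -/(jdist x y) in hT.
  set u := f^`().[val x] * (val y - val x) in hT.
  have eu : cabs u = jderiv x * jdist x y by rewrite cabsM [X in _ * X]cabsB.
  have ev : jdist (jmap x) (jmap y) = cabs (f.[val y] - f.[val x]) by rewrite
    /jdist cabsB.
  rewrite -eu ev; set v := f.[val y] - _ in hT *.
  have h1 := cabsD (v - u) u; have h2 := cabsD (u - v) v.
  rewrite subrK in h1; rewrite subrK [cabs (u - v)]cabsB in h2.
  by split; lra.
exists lam, (Num.max L1 L2), (2 * B + B1), del; split=> //.
- by move=> x y; apply: cabs_ge0.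
- by move=> x y; apply: cabsB.
- by move=> y x z; apply: cabs_triangle.
- move=> x y; split=> [/cabs_eq0/eqP|->]; last by rewrite /jdist subrr cabs0.
  by rewrite subr_eq0 => /eqP/val_inj.
- exists (M + M) => x y; apply: le_trans (cabsD _ _) _.
  by rewrite cabsN lerD// hM//; apply: jpointP.
- move=> u e e0 ue.
  have [x jx hx] := julia_cluster (fun n => jpointP (u n)).
  exists (jpoint jx) => n; apply/ler_addgt0Pr => r r0.
  have [m nm hm] := hx r r0 n.
  rewrite /jdist [leRHS]addrC; apply: le_trans (cabs_triangle (val (u m)) _ _)
    _.
  by apply: lerD; [rewrite cabsB ltW|apply: ue].
- by rewrite addr_ge0// mulr_ge0.
- by move=> x; apply/hlam/jpointP.
- by move=> x; rewrite le_max hL1// hM//; apply: jpointP.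
- move=> x y; rewrite /jdist /=.
  apply: le_trans (hL2 _ _ (hM _ (jpointP y)) (hM _ (jpointP x))) _.
  by rewrite ler_wpM2r ?cabs_ge0// le_max lexx orbT.
- move=> x y xy; rewrite /jdist cabsB [leRHS]cabsB; apply: expand;
  first exact: jpointP.
  by rewrite cabsB (le_trans xy).
- move=> x y xy; have [h1 _] := near x y xy.
  exact: (upper_distortion (w1 x) (cabs_ge0 _) B0 B10 h1).
- move=> x y xy; have [_ h2] := near x y xy.
  apply: (lower_distortion (w1 x) (cabs_ge0 _) (cabs_ge0 _) B0 B10 _ h2).
  by apply: le_trans Bs; rewrite ler_wpM2l// (le_trans xy).
- move=> x y xy; have := lip1 _ _ (jpointP y) (jpointP x);
  rewrite -/(jdist x y) => h1.
  have := cabsD (f^`().[val x] - f^`().[val y]) f^`().[val y];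
    rewrite subrK => h2.
  have hw := hlam _ (jpointP y); rewrite -!/(jderiv _) in h1 h2 hw *.
  apply: le_trans h2 _; rewrite mulrDr mulr1 addrC lerD2l; apply: le_trans h1 _.
  have t0 : 0 <= jdist x y by apply: cabs_ge0.
  apply: (@le_trans _ _ ((2 * B + B1) * jdist x y)).
    by rewrite ler_wpM2r// lerDr mulr_ge0.
  by rewrite ler_peMl ?w1// mulr_ge0// addr_ge0// mulr_ge0.
- move=> x y xy; have [x' [jx' x'y] hx'] := lift _ _ (jpointP y) xy.
  by exists (jpoint jx') => //; apply: val_inj.
- move=> r r0; have r2 : 0 < r / 2 by rewrite divr_gt0.
  have [n1 hn1] := expr_large (del / (r / 2)) lam1.
  have [n2 hn2] := expr_large (4 * (2 * M) ^+ 2 / (r / 2 * del) + 1) lam1.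
  exists (maxn n1 n2).+1 => // x y; set n := (maxn n1 n2).+1.
  have {}hn1 := hn1 n (leqW (leq_maxl _ _)).
  have {}hn2 := hn2 n (leqW (leq_maxr _ _)).
  apply: contrapT => hno.
  have omit w : cabs (w - val x) <= r / 2 ->
    del <= cabs (iter_poly f n - (val y)%:P).[w].
    move=> wx; rewrite hornerD hornerN hornerC iter_polyE leNgt;
      apply/negP => hw.
    have [z [jz zy] wz] := shadowC n w _ (jpointP y) (ltW hw).
    apply: hno; exists (jpoint jz); last by apply: val_inj;
      rewrite val_iter_jmap.
    rewrite /jdist [r]splitr; apply: le_trans (cabs_triangle w _ _) _.
    rewrite cabsB lerD// ?[cabs (val x - w)]cabsB//.
    rewrite ler_pdivrMr// in hn1.
    have h := le_trans wz (le_trans (ltW hw) hn1).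
    by rewrite ler_pM2l ?exprn_gt0// in h.
  have := cauchy_inverse (ltW r2) del0 omit.
  rewrite derivB derivC subr0 iter_poly_deriv hornerD hornerN hornerC
    iter_polyE.
  apply/negP; rewrite -ltNge.
  have rd : 0 < r / 2 * del by rewrite mulr_gt0.
  apply: (@le_lt_trans _ _ (4 * (2 * M) ^+ 2)).
    rewrite ler_pM2l// lerXn2r ?nnegrE ?cabs_ge0 ?mulr_ge0 ?(ltW M0)//.
    apply: le_trans (cabsD _ _) _; rewrite cabsN mulr2n mulrDl mul1r.
    by apply: lerD; apply: hM; [apply: julia_iter|]; apply: jpointP.
  rewrite -ltr_pdivrMr//; apply: (@lt_le_trans _ _ (lam ^+ n)).
    by apply: lt_le_trans hn2; rewrite ltrDl.
  have -> : cabs (\prod_(i < n) f^`().[iter i F (val x)]) =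
      \prod_(i < n) cabs f^`().[iter i F (val x)].
    exact: (big_morph (@cabs R) (@cabsM R) (@cabs1 R)).
  rewrite -[X in lam ^+ X]card_ord -prodr_const; apply: ler_prod => i _.
  by rewrite (ltW lam0)/= hlam//; apply: julia_iter; apply: jpointP.
move=> y; have [r er] := closed_field_poly_normal (f - (val y)%:P).
exists (pmap insub r) => x e.
have lc0 : lead_coef (f - (val y)%:P) != 0.
  rewrite lead_coefDl ?lead_coef_eq0 -?size_poly_gt0; first by rewrite ltnW.
  by rewrite size_polyN size_polyC; case: eqP => // _; apply: leq_trans sf1.
rewrite mem_pmap_sub -root_prod_XsubC -(rootZ _ _ lc0) -er /root.
by rewrite hornerD hornerN hornerC -e /= subrr.
Qed.
End JuliaSystem.
Arguments jpointP {R f} x.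

(** * Hausdorff measure and dimension *)

Section Hausdorff.
Variable R : realType.
Implicit Types (A B : set R[i]^o) (s t delta : R).

Lemma diameter_pow_ge0 s A : (0 <= diameter_pow s A)%E.
Proof. by rewrite /diameter_pow; case: ifP => // _; apply: poweR_ge0. Qed.

Lemma diameter_ub A x y : A x -> A y -> ((cabs (x - y))%:E <= diameter A)%E.
Proof. by move=> Ax Ay; apply: ereal_sup_ubound; exists x => //; exists y. Qed.

Lemma diameter_le A r : (forall x y, A x -> A y -> cabs (x - y) <= r) ->
  (diameter A <= r%:E)%E.
Proof.
by move=> h; apply: ge_ereal_sup => _ [x Ax [y Ay <-]]; rewrite lee_fin h.
Qed.

Lemma diameter_real A delta : A !=set0 -> (diameter A <= delta%:E)%E ->
  exists2 r, diameter A = r%:E & 0 <= r <= delta.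
Proof.
move=> [x Ax] hd; have h0 := diameter_ub Ax Ax; rewrite subrr cabs0 in h0.
exists (fine (diameter A)).
  rewrite fineK// fin_numE -ltNye -ltey.
  by rewrite (lt_le_trans (ltNyr 0) h0) (le_lt_trans hd (ltry _)).
by rewrite fine_ge0//= -lee_fin fineK// fin_numE -ltNye -ltey
  (lt_le_trans (ltNyr 0) h0) (le_lt_trans hd (ltry _)).
Qed.

Lemma hausdorff_premeasure_ge0 s delta A :
  (0 <= hausdorff_premeasure s delta A)%E.
Proof.
apply: le_ereal_inf_tmp => _ [U _ <-]; apply: nneseries_ge0 => n _ _.
exact: diameter_pow_ge0.
Qed.

Lemma hausdorff_premeasure_le s delta A : 0 < delta ->
  (hausdorff_premeasure s delta A <= hausdorff_measure s A)%E.
Proof. by move=> d0; apply: ereal_sup_ubound; exists delta. Qed.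

Lemma hausdorff_measure_ge0 s A : (0 <= hausdorff_measure s A)%E.
Proof.
exact: le_trans (hausdorff_premeasure_ge0 s 1 A) (hausdorff_premeasure_le s A
  ltr01).
Qed.

Lemma hausdorff_measure_subset s A B : A `<=` B ->
  (hausdorff_measure s A <= hausdorff_measure s B)%E.
Proof.
move=> AB; apply: ge_ereal_sup => _ [delta d0 <-].
apply: le_trans (hausdorff_premeasure_le s B d0).
apply: ereal_inf_le_tmp => _ [U [BU dU] <-]; exists U => //; split=> //.
exact: subset_trans AB BU.
Qed.

Lemma hausdorff_dim_subset A B : A `<=` B ->
  (hausdorff_dim A <= hausdorff_dim B)%E.
Proof.
move=> AB; apply: ereal_inf_le_tmp => _ [s [s0 hs] <-]; exists s => //;
  split=> //.
apply/eqP; rewrite eq_le hausdorff_measure_ge0 andbT -hs.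
exact: hausdorff_measure_subset.
Qed.

Lemma finite_cover_premeasure s delta A (X : Type) (r : X -> R)
    (U : X -> set R[i]^o) (l : seq X) :
    (forall y, r y <= delta) -> 0 < delta ->
    (forall y x z, U y x -> U y z -> cabs (x - z) <= r y) ->
    (forall y, U y !=set0) -> 0 <= s ->
    A `<=` (fun x => exists i, exists2 y, (onth l i) = Some y & U y x) ->
  (hausdorff_premeasure s delta A <= (\sum_(y <- l) r y `^ s)%:E)%E.
Proof.
move=> rd d0 hU Une s0 cov.
pose V n : set R[i]^o := if onth l n is Some y then U y else set0.
apply: (@le_trans _ _ (\sum_(0 <= n <oo) diameter_pow s (V n))%E).
  apply: ereal_inf_lbound; exists V => //; split.
    by move=> x /cov [i [y hy Uyx]]; exists i => //; rewrite /V hy.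
  move=> n; rewrite /V; case: (onth l n) => [y|].
    by apply: le_trans (diameter_le (hU y)) _; rewrite lee_fin.
  by apply: le_trans (@diameter_le set0 0 _) _ => //; rewrite lee_fin ltW.
have V0 n : (0 <= diameter_pow s (V n))%E by apply: diameter_pow_ge0.
apply: lime_le; first by apply: is_cvg_nneseries.
near=> n; have ln : (size l <= n)%N by near: n; exists (size l).
rewrite (big_cat_nat (n := size l))//= [X in (_ + X)%E]big_nat_cond.
rewrite [X in (_ + X)%E]big1 ?adde0; last first.
  move=> i /andP[/andP[li _] _]; rewrite /V onth_default//.
  by rewrite /diameter_pow eqxx.
rewrite -sumEFin.
have V_le y : (diameter_pow s (U y) <= (r y `^ s)%:E)%E.
  rewrite /diameter_pow; case: eqP => [e|_].
    by rewrite lee_fin powR_ge0.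
  have [q qE /andP[q0 _]] := diameter_real (Une y) (diameter_le (hU y)).
  rewrite qE poweR_EFin lee_fin ge0_ler_powR ?nnegrE//.
    rewrite -lee_fin; apply: le_trans (_ : q%:E <= _)%E;
      first by rewrite lee_fin.
    by rewrite -qE; apply: diameter_le; apply: hU.
  by rewrite -lee_fin -qE; apply: diameter_le; apply: hU.
elim: (l) @V V0 {ln} => [|y l' IH] V V0; first by rewrite big_geq// big_nil.
rewrite big_nat_recl// big_cons; apply: leeD; first exact: V_le.
by apply: IH => m; exact: diameter_pow_ge0.
Unshelve. all: by end_near. Qed.

End Hausdorff.

(** * Irregular points of full dimension *)

Section Assembly.
Variables (R : realType) (f : {poly R[i]}).
Hypothesis degf : (2 < size f)%N.
Hypothesis expf : forall z : R[i]^o, julia_set f z -> 1 < cabs f^`().[z].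
Local Notation C := R[i].
Local Notation J := (julia_set f).
Local Notation X := (set_type J).
Local Notation F := (@jmap R f).
Local Notation dist := (@jdist R f).

(** Averages diverge as soon as one of their two coordinates does, and a
    function both of whose coordinates are cohomologous to constants is so
    itself.  This reduces the problem to real functions. *)
Definition coordinate (b : bool) (z : C) : R :=
  if b then complex.Re z else complex.Im z.

Lemma coordinateD b : {morph coordinate b : x y / x + y}.
Proof. by case: b => -[? ?] [? ?]. Qed.

Lemma coordinateB b x y : coordinate b (x - y) = coordinate b x - coordinate b
  y.
Proof. by case: b x y => -[? ?] [? ?]. Qed.

Lemma coordinate_le b z : `|coordinate b z| <= cabs z.
Proof. by case: b; [apply: Re_le_cabs|apply: Im_le_cabs]. Qed.

Lemma coordinate_sum b n (u : 'I_n -> C) :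
  coordinate b (\sum_(i < n) u i) = \sum_(i < n) coordinate b (u i).
Proof. by apply: (big_morph _ (coordinateD b)); case: b. Qed.

Lemma coordinate_natV b n z : coordinate b (n%:R^-1 * z) = coordinate b z /
  n%:R.
Proof.
have -> : (n%:R^-1 : C) = (n%:R^-1)%:C by rewrite fmorphV rmorph_nat.
by case: b z => -[x y] /=; rewrite mul0r ?subr0 ?addr0 mulrC.
Qed.

Lemma coordinate_ergodic_average b (g : R[i]^o -> R[i]^o) (x : X) n :
  coordinate b (ergodic_average f g (val x) n) =
  birkhoff F (fun y => coordinate b (g (val y))) n x / n%:R.
Proof.
rewrite coordinate_natV coordinate_sum; congr (_ / _); apply: eq_bigr => i _.
by rewrite val_iter_jmap.
Qed.

Lemma coordinate_holder b (g : R[i]^o -> R[i]^o) : holder_on J g ->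
  exists al H, holder dist (fun x : X => coordinate b (g (val x))) al H.
Proof.
move=> [al [c [al0 _ hg]]]; exists al, `|c|; split=> // x y.
rewrite -coordinateB; apply: le_trans (coordinate_le _ _) _.
apply: le_trans (hg _ _ (jpointP x) (jpointP y)) _.
by rewrite ler_wpM2r ?powR_ge0// ler_norm.
Qed.

Lemma cohomologous_of_coordinates del (g : R[i]^o -> R[i]^o) : 0 < del ->
    (forall b, cohomologous_const dist F del
       (fun x : X => coordinate b (g (val x)))) ->
  cohomologous_to_constant f g.
Proof.
move=> del0 h.
have [m1 [u1 [al1 [H1 [al10 H10 hu1]]] e1]] := h true.
have [m2 [u2 [al2 [H2 [al20 H20 hu2]]] e2]] := h false.
pose u (z : R[i]^o) : R[i]^o :=
  if pselect (J z) is left jz then Complex (u1 (jpoint jz)) (u2 (jpoint jz))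
    else 0.
have uE (x : X) : u (val x) = Complex (u1 x) (u2 x).
  rewrite /u; case: pselect => [jz|]; last by case; apply: jpointP.
  by have -> : jpoint jz = x by apply: val_inj.
exists (Complex m1 m2), u; split; last first.
  move=> z jz; have -> : z = val (jpoint jz) by [].
  have -> : f.[val (jpoint jz)] = val (F (jpoint jz)) by [].
  rewrite !uE; have := e1 (jpoint jz); have := e2 (jpoint jz).
  by case: (g _) => a b /= -> ->.
have modulus (v : X -> R) al H x eps : 0 < al -> 0 <= H -> 0 < eps ->
    (forall x y : X, dist x y <= del -> `|v x - v y| <= H * dist x y `^ al) ->
    exists2 r, 0 < r & forall y : X, dist x y < r -> `|v x - v y| < eps.
  move=> al0 H0 eps0 hv; set q := eps / (H + 1).
  have q0 : 0 < q by rewrite divr_gt0// ltr_wpDl.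
  exists (Num.min del (q `^ al^-1)); first by rewrite lt_min del0 powR_gt0.
  move=> y; rewrite lt_min => /andP[/ltW xy1 xy2].
  apply: le_lt_trans (hv _ _ xy1) _.
  have hq : dist x y `^ al < q.
    have -> : q = (q `^ al^-1) `^ al.
      by rewrite -powRrM mulVf ?lt0r_neq0// powRr1 ?(ltW q0).
    by rewrite gt0_ltr_powR ?nnegrE ?cabs_ge0 ?powR_ge0.
  apply: (@le_lt_trans _ _ ((H + 1) * dist x y `^ al)).
    by rewrite ler_wpM2r ?powR_ge0// lerDl.
  by rewrite mulrC -ltr_pdivlMr// ltr_wpDl.
apply/subspace_continuousP => z jz V /nbhs_cabs[r r0 rV].
have r2 : 0 < r / 2 by rewrite divr_gt0.
have [s1 s10 hs1] := modulus u1 al1 H1 (jpoint jz) (r / 2) al10 H10 r2 hu1.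
have [s2 s20 hs2] := modulus u2 al2 H2 (jpoint jz) (r / 2) al20 H20 r2 hu2.
apply/nbhs_cabs; exists (Num.min s1 s2); first by rewrite lt_min s10.
move=> w; rewrite lt_min => /andP[h1 h2] jw; apply: rV.
rewrite -[_ - _]/(u (val (jpoint jw)) - u (val (jpoint jz))).
rewrite !uE cabsB; apply: le_lt_trans (cabs_le_ReIm _) _.
by rewrite [ltRHS]splitr ltrD//= ?hs1 ?hs2// /jdist cabsB.
Qed.

Lemma julia_cover_bound t delta h : 0 < delta -> 0 <= t ->
  (h%:E <= hausdorff_premeasure t delta J)%E ->
  cover_bound dist t (h / 2 `^ t) (delta / 2).
Proof.
move=> delta0 t0 hJ l r hr hcov.
rewrite ler_pdivrMr ?powR_gt0// mulrC mulr_sumr -lee_fin.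
apply: le_trans hJ _.
have -> : \sum_(y <- l) 2 `^ t * r y `^ t = \sum_(y <- l) (2 * r y) `^ t.
  by apply: eq_bigr => y _; rewrite powRM//; have /andP[/ltW] := hr y.
apply: (finite_cover_premeasure (r := fun y => 2 * r y)
  (U := fun y : X => [set z : R[i]^o | cabs (val y - z) <= r y])) => //.
- by move=> y; rewrite mulrC -ler_pdivlMr//; have /andP[] := hr y.
- move=> y x z /= hx hz; apply: le_trans (cabs_triangle (val y) _ _) _.
  by rewrite mulr2n mulrDl mul1r lerD// cabsB.
- by move=> y; exists (val y); rewrite /= subrr cabs0; have /andP[/ltW] := hr y.
move=> x jx; have [y yl hy] := hcov (jpoint jx).
exists (index y l), y; first by rewrite onthE (nth_map y) ?index_mem//
  nth_index.
by rewrite /= cabsB.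
Qed.

Lemma divergent_of_coordinate b (g : R[i]^o -> R[i]^o) (x : X) :
    not_cauchy (fun T => birkhoff F (fun y => coordinate b (g (val y))) T x /
      T%:R) ->
  ~ cvg (ergodic_average f g (val x) @ \oo).
Proof.
move=> [eps eps0 hx] /cvg_ex[l hl].
have e2 : 0 < eps / 2 by rewrite divr_gt0.
have : nbhs l [set w : R[i]^o | cabs (w - l) < eps / 2].
  by apply/nbhs_cabs; exists (eps / 2).
move=> /hl[N _ hN]; have [T1 [T2 [h1 h2]]] := hx N.
rewrite -!coordinate_ergodic_average -coordinateB; apply/negP; rewrite -ltNge.
apply: le_lt_trans (coordinate_le _ _) (le_lt_trans (cabs_triangle l _ _) _).
by rewrite [ltRHS]splitr ltrD//; [apply: hN|rewrite cabsB; apply: hN].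
Qed.

Lemma sum_halves n : \sum_(j < n) (2 ^+ j.+1)^-1 <= 1 :> R.
Proof.
suff -> : \sum_(j < n) (2 ^+ j.+1)^-1 = 1 - (2 ^+ n)^-1 :> R.
  by rewrite gerBl invr_ge0 exprn_ge0.
elim: n => [|n IH]; first by rewrite big_ord0 expr0 invr1 subrr.
rewrite big_ord_recr /= IH exprS.
have n2 : (2 : R) ^+ n != 0 by rewrite expf_neq0.
by field; rewrite n2.
Qed.

Variable g : nat -> R[i]^o -> R[i]^o.
Hypothesis g_holder : forall k, holder_on J (g k).
Hypothesis g_ncoh : forall k, ~ cohomologous_to_constant f (g k).

Definition irregular_set : set R[i]^o := [set z | J z /\
  forall k, ~ cvg (ergodic_average f (g k) z @ \oo)].

(** A cover of the irregular set with small s-sum has a small t-sum as well,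
    as its diameters are at most 1.  The diameters are enlarged a little in
    order to make them positive; [irregular_set_escapes] then gives a point
    of the irregular set outside the cover. *)
Lemma irregular_set_not_null s t t' : 0 <= s -> s <= t -> 0 < t -> t < t' ->
  hausdorff_measure t' J <> 0%E -> hausdorff_measure s irregular_set <> 0%E.
Proof.
move=> s0 st t0 tt' hJ hE.
have [lam [L [c [del sys]]]] := julia_expanding_system degf expf.
have : (0 < hausdorff_measure t' J)%E.
  by rewrite lt_def hausdorff_measure_ge0 andbT; apply/eqP.
move=> /ereal_sup_gt[_ [delta delta0 <-] hpos].
have [h h0 hle] : exists2 h : R, 0 < h &
  (h%:E <= hausdorff_premeasure t' delta J)%E.
  move: hpos; case: (hausdorff_premeasure _ _ _) => [r|_|//].
    by rewrite lte_fin => r0; exists r.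
  by exists 1 => //; rewrite leey.
have t'0 : 0 <= t' by apply: ltW (lt_trans t0 tt').
have cov := julia_cover_bound delta0 t'0 hle.
have h20 : 0 < h / 2 `^ t' by rewrite divr_gt0// powR_gt0.
have d20 : 0 < delta / 2 by rewrite divr_gt0.
have [a _] : exists a : X, True.
  apply: contrapT => hno; have := hle; apply/negP; rewrite -ltNge.
  apply: le_lt_trans (_ : (0%:E < h%:E)%E); last by rewrite lte_fin.
  have := @finite_cover_premeasure R t' delta J unit (fun _ => delta)
    (fun _ => [set 0]) [::]; rewrite big_nil; apply=> //.
  - by move=> _ x z -> ->; rewrite subrr cabs0 ltW.
  - by move=> _; exists 0.
  - by move=> z jz; case: hno; exists (jpoint jz).
have hb k : exists b, ~ cohomologous_const dist F del (fun x :
  X => coordinate b (g k (val x))).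
  apply: contrapT => hno; apply: (g_ncoh (k := k)).
  apply: (cohomologous_of_coordinates (es_del sys)) => b; apply: contrapT => hb.
  by apply: hno; exists b.
have [b hbk] := choice hb.
have [kappa kappa0 hk] := irregular_set_escapes sys a t0 tt' h20 d20 cov
  (fun k => coordinate_holder (b k) (g_holder k)) hbk.
have k20 : 0 < kappa / 2 by rewrite divr_gt0.
have : (hausdorff_premeasure s 1 irregular_set < (kappa / 2)%:E)%E.
  apply: le_lt_trans (hausdorff_premeasure_le s _ ltr01) _.
  by rewrite hE lte_fin.
move=> /ereal_inf_lt[_ [U [EU dU] <-] sumU].
pose D j := if pselect (U j !=set0) then fine (diameter (U j)) else 0.
have DP j : [/\ 0 <= D j, (forall x y, U j x -> U j y -> cabs (x - y) <= D j) &
    ((D j `^ t)%:E <= diameter_pow s (U j))%E].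
  rewrite /D; case: pselect => [ne|em]; last first.
    split=> [//|x y Ux|]; first by case: em; exists x.
    by rewrite powR0 ?gt_eqF// diameter_pow_ge0.
  have [q qE /andP[q0 q1]] := diameter_real ne (dU j).
  rewrite qE /=; split=> //.
    by move=> x y Ux Uy; rewrite -lee_fin -qE diameter_ub.
  rewrite /diameter_pow; case: eqP => [e|_].
    by move: ne; rewrite e => -[].
  rewrite qE poweR_EFin lee_fin.
  have [->|q_neq0] := eqVneq q 0; first by rewrite powR0 ?gt_eqF// powR_ge0.
  have h1 : q `^ (t - s) <= 1.
    have -> : 1 = 1 `^ (t - s) :> R by rewrite powR1.
    by rewrite ge0_ler_powR ?nnegrE ?subr_ge0.
  rewrite -[t in leLHS](subrK s) powRD; last by apply/implyP.
  by rewrite ler_piMl ?powR_ge0.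
(* These have t-th powers with sum at most kappa / 2. *)
pose eta j := (kappa / 2 * (2 ^+ j.+1)^-1) `^ t^-1.
have eta0 j : 0 < kappa / 2 * (2 ^+ j.+1)^-1.
  by rewrite mulr_gt0// invr_gt0 exprn_gt0.
pose r j := Num.max (D j) (eta j).
have r_t j : r j `^ t <= D j `^ t + kappa / 2 * (2 ^+ j.+1)^-1.
  have etaE : eta j `^ t = kappa / 2 * (2 ^+ j.+1)^-1.
    by rewrite -powRrM mulVf ?gt_eqF// powRr1// ltW.
  rewrite -etaE /r; case: (leP (D j) (eta j)) => _;
    first by rewrite lerDr powR_ge0.
  by rewrite lerDl powR_ge0.
have sumD n : \sum_(j < n) D j `^ t <= kappa / 2.
  rewrite -lee_fin -sumEFin; apply: le_trans (ltW sumU).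
  rewrite -(big_mkord xpredT (fun j => (D j `^ t)%:E)).
  apply: le_trans (nneseries_lim_ge n (fun k _ _ => diameter_pow_ge0 s (U k))).
  by apply: lee_sum => j _; have [] := DP j.
have [| | |x hxU hx] := hk (fun j => [set x : X | U j (val x)]) r.
- by move=> j; rewrite lt_max powR_gt0 ?orbT.
- by move=> j x y /= Ux Uy; rewrite le_max; have [_ hD _] := DP j;
  rewrite /jdist hD.
- move=> n; apply: (@le_trans _ _ (\sum_(j < n) D j `^ t +
      kappa / 2 * \sum_(j < n) (2 ^+ j.+1)^-1)).
    by rewrite mulr_sumr -big_split /=; apply: ler_sum.
  rewrite [leRHS]splitr lerD// ger_pMr//; exact: sum_halves.
have [j _ Ujx] : (\bigcup_n U n) (val x).
  apply: EU; split=> [|k]; first exact: jpointP.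
  exact: divergent_of_coordinate (hx k).
exact: hxU j Ujx.
Qed.
End Assembly.

Theorem corollary3 (R : realType) (f : {poly R[i]})
    (degf : (2 < size f)%N)
    (expf : forall z : R[i]^o, julia_set f z -> 1 < cabs f^`().[z])
    (g : nat -> R[i]^o -> R[i]^o)
    (g_holder : forall k : nat, holder_on (julia_set f) (g k))
    (g_ncoh : forall k : nat, ~ cohomologous_to_constant f (g k)) :
  hausdorff_dim [set z : R[i]^o | julia_set f z /\
      forall k : nat, ~ cvg (ergodic_average f (g k) z @ \oo)]
  = hausdorff_dim (julia_set f).
Proof.
apply/eqP; rewrite eq_le; apply/andP; split.
  by apply: hausdorff_dim_subset => z [].
rewrite leNgt; apply/negP => /ereal_inf_lt[_ [s [s0 hs] <-] hJ].
have [t [t' [st t0 tt' ht']]] : exists t t' : R, [/\ s <= t, 0 < t, t < t' &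
    (t'%:E < hausdorff_dim (julia_set f))%E].
  move: hJ; case: (hausdorff_dim _) => [r|_|]; last by rewrite ltNge leNye.
    rewrite lte_fin => sr; exists ((2 * s + r) / 3), ((s + 2 * r) / 3).
    by rewrite lte_fin; split; lra.
  by exists (s + 1), (s + 2); rewrite ltry; split=> //; lra.
apply: (irregular_set_not_null degf expf g_holder g_ncoh s0 st t0 tt' _ hs) =>
  h.
move: ht'; apply/negP; rewrite -leNgt; apply: ereal_inf_lbound.
by exists t' => //; split=> //; apply: ltW (lt_trans t0 tt').
Qed.
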